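(* Let $K$ be a field and let $A$ be a prime affine (that is, finitely generated; unital, associative) $K$-algebra of quadratic growth. Then either $A$ satisfies a polynomial identity or the extended centre of $A$ is algebraic over $K$.
   Context: All algebras are associative with identity; ideals are two-sided. Polynomial identities are nontrivial ones. Quadratic growth: for a $K$-subspace $V$ of $A$, $V^n$ denotes the $K$-span of all products of $n$ elements of $V$. A finitely generated $K$-algebra $A$ has quadratic growth if for every finite-dimensional $K$-subspace $V$ of $A$ that contains $1$ and generates $A$ as a $K$-algebra, there exist positive constants $C_1$ and $C_2$ such that $C_1n^2<\dim_K V^n<C_2n^2$ for all $n\ge 1$. Extended centre: for a prime algebra $A$, the Martindale ring of quotients is the set of equivalence classes of pairs $(I,f)$, where $I$ is a nonzero ideal of $A$ and $f:I\to A$ is a homomorphism of right $A$-modules, with $(I,f)\sim(J,g)$ if $f$ and $g$ agree on some nonzero ideal contained in $I\cap J$; addition is pointwise on $I\cap J$, and the product of the classes of $(I,f)$ and $(J,g)$ is the class of $(JI, f\circ g)$. It contains $A$ via left multiplications. The extended centre of $A$ is the centre of this ring; it is a field containing $K$. *)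

(* Defs.v *)
From HB Require Import structures.
From mathcomp Require Import all_boot all_order all_algebra generic_quotient.
From mathcomp Require Import boolp classical_sets cardinality reals.
From mathcomp Require Import monalg.

Set Implicit Arguments.
Unset Strict Implicit.
Unset Printing Implicit Defensive.

Import Order.TTheory GRing.Theory Num.Theory.

Local Open Scope classical_set_scope.
Local Open Scope quotient_scope.
Local Open Scope ring_scope.

Section Growth.
Variables (K : fieldType) (A : algType K).
Implicit Types (S V : set A) (d n : nat).

Definition lin_span S : set A :=
  [set a | exists n (c : 'I_n -> K) (x : 'I_n -> A),
     (forall i, S (x i)) /\ a = \sum_(i < n) c i *: x i].

Definition lin_indep d (b : 'I_d -> A) : Prop :=
  forall c : 'I_d -> K, \sum_(i < d) c i *: b i = 0 -> forall i, c i = 0.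

(* In particular V is a K-subspace of A. *)
Definition has_dim V d : Prop :=
  exists b : 'I_d -> A, lin_indep b /\ V = lin_span (range b).

Definition subspace_pow V n : set A :=
  lin_span [set a | exists x : 'I_n -> A,
     (forall i, V (x i)) /\ a = \prod_(i < n) x i].

Definition generates V : Prop :=
  forall B : {pred A}, subalg_closed B ->
    (forall v, V v -> v \in B) -> forall a, a \in B.

Definition affine : Prop := exists X : set A, finite_set X /\ generates X.

Definition quadratic_growth (R : realType) : Prop :=
  forall V, (exists d, has_dim V d) -> V 1 -> generates V ->
    exists C1 C2 : R, [/\ 0 < C1, 0 < C2 &
      forall n, (1 <= n)%N -> exists d, has_dim (subspace_pow V n) d /\
        C1 * n%:R ^+ 2 < d%:R < C2 * n%:R ^+ 2].

End Growth.

Section PolynomialIdentity.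
Variables (K : fieldType) (A : algType K).

(* The monoid algebra of the free monoid of words on 'I_m is the free algebra
   K<x_0, ..., x_{m-1}>; this is evaluation at x_i := x i. *)
Definition nc_eval m (x : 'I_m -> A) (f : {malg K[{fmonom 'I_m}]}) : A :=
  mmap (in_alg A) (fun w : {fmonom 'I_m} => \prod_(i <- (w : seq 'I_m)) x i) f.

Definition satisfies_PI : Prop :=
  exists m (f : {malg K[{fmonom 'I_m}]}),
    f != 0 /\ forall x : 'I_m -> A, nc_eval x f = 0.

End PolynomialIdentity.

Section Ideals.
Variable A : nzRingType.
Implicit Types (I J L : set A).

Definition is_ideal I : Prop :=
  [/\ I 0, forall x y, I x -> I y -> I (x + y),
      forall a x, I x -> I (a * x) & forall a x, I x -> I (x * a)].

Definition nonzero_ideal I : Prop := is_ideal I /\ I <> [set 0].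

Definition ideal_mul I J : set A :=
  [set a | exists n (x y : 'I_n -> A),
     (forall i, I (x i) /\ J (y i)) /\ a = \sum_(i < n) x i * y i].

(* nzRingType already excludes the zero ring. *)
Definition prime_ring : Prop :=
  forall I J, is_ideal I -> is_ideal J -> ideal_mul I J = [set 0] ->
    I = [set 0] \/ J = [set 0].

Lemma ideal_mul_ind I J L : L 0 -> (forall x y, L x -> L y -> L (x + y)) ->
  (forall x y, I x -> J y -> L (x * y)) -> ideal_mul I J `<=` L.
Proof.
move=> L0 LD LM a [n [x [y [xy ->]]]].
by apply: (big_ind L) => // i _; have [? ?] := xy i; apply: LM.
Qed.

Lemma ideal_mulM I J x y : I x -> J y -> ideal_mul I J (x * y).
Proof.
by move=> Ix Jy; exists 1%N, (fun=> x), (fun=> y); rewrite big_ord1.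
Qed.

Lemma ideal_mulD I J a b :
  ideal_mul I J a -> ideal_mul I J b -> ideal_mul I J (a + b).
Proof.
move=> [n [x [y [xy ->]]]] [m [z [t [zt ->]]]].
exists (n + m)%N, (fun i => match split i with inl j => x j | inr j => z j end),
  (fun i => match split i with inl j => y j | inr j => t j end); split.
  by move=> i; case: (split i).
rewrite big_split_ord /=; congr (_ + _); apply: eq_bigr => i _.
  by rewrite -[lshift _ _]/(unsplit (inl i)) unsplitK.
by rewrite -[rshift _ _]/(unsplit (inr i)) unsplitK.
Qed.

Lemma ideal_mul0 I J : ideal_mul I J 0.
Proof.
by exists 0%N, (fun=> 0), (fun=> 0); split; [case | rewrite big_ord0].
Qed.

Lemma ideal_mul_ideal I J : is_ideal I -> is_ideal J -> is_ideal (ideal_mul I J).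
Proof.
move=> [_ _ Il _] [_ _ _ Jr]; split; [exact: ideal_mul0|exact: ideal_mulD| |].
  move=> a; apply: (@ideal_mul_ind I J (fun u => ideal_mul I J (a * u))).
  - by rewrite mulr0; exact: ideal_mul0.
  - by move=> x y ? ?; rewrite mulrDr; exact: ideal_mulD.
  - by move=> x y Ix Jy; rewrite mulrA; apply: ideal_mulM => //; exact: Il.
move=> a; apply: (@ideal_mul_ind I J (fun u => ideal_mul I J (u * a))).
- by rewrite mul0r; exact: ideal_mul0.
- by move=> x y ? ?; rewrite mulrDl; exact: ideal_mulD.
- by move=> x y Ix Jy; rewrite -mulrA; apply: ideal_mulM => //; exact: Jr.
Qed.

Lemma ideal_mul_subl I J : is_ideal I -> ideal_mul I J `<=` I.
Proof.
by move=> [I0 ID _ Ir]; apply: ideal_mul_ind => // x y Ix _; exact: Ir.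
Qed.

Lemma ideal_mul_subr I J : is_ideal J -> ideal_mul I J `<=` J.
Proof.
by move=> [J0 JD Jl _]; apply: ideal_mul_ind => // x y _ Jy; exact: Jl.
Qed.

Lemma ideal_mulS I J I' J' : I `<=` I' -> J `<=` J' ->
  ideal_mul I J `<=` ideal_mul I' J'.
Proof.
move=> sI sJ; apply: ideal_mul_ind; [exact: ideal_mul0|exact: ideal_mulD|].
by move=> x y /sI Ix /sJ Jy; exact: ideal_mulM.
Qed.

Lemma nonzero_ideal_mul : prime_ring -> forall I J,
  nonzero_ideal I -> nonzero_ideal J -> nonzero_ideal (ideal_mul I J).
Proof.
move=> pA I J [iI I0] [iJ J0]; split; first exact: ideal_mul_ideal.
by move=> /(pA _ _ iI iJ)[].
Qed.

Lemma nonzero_idealT : nonzero_ideal [set: A].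
Proof.
split=> // /seteqP[/(_ 1 Logic.I) /= /eqP]; by rewrite oner_eq0.
Qed.

Definition right_linear_on I (f : A -> A) : Prop :=
  (forall x y, I x -> I y -> f (x + y) = f x + f y) /\
  (forall x a, I x -> f (x * a) = f x * a).

Lemma right_linear0 I f : is_ideal I -> right_linear_on I f -> f 0 = 0.
Proof. by move=> [I0 _ _ _] [_ /(_ 0 0 I0)]; rewrite !mulr0. Qed.

Lemma right_linear_mul I J L f : is_ideal I -> is_ideal L ->
  right_linear_on I f -> J `<=` I -> forall x, ideal_mul J L x -> L (f x).
Proof.
move=> iI iL fP sJ x xJL; have f0 := right_linear0 iI fP; case: fP => fD fM.
have [I0 ID Il Ir] := iI; have [L0 LD Ll Lr] := iL.
suff [] : I x /\ L (f x) by [].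
move: x xJL; apply: (@ideal_mul_ind J L (fun u => I u /\ L (f u))).
- by rewrite f0.
- by move=> x y [? ?] [? ?]; rewrite fD //; split; [exact: ID|exact: LD].
- by move=> x y /sJ Ix Ly; rewrite fM //; split; [exact: Ir|exact: Ll].
Qed.

End Ideals.

(* A pair (I, f) with f : I -> A; f is carried by a total function whose values
   outside I are ignored by mequiv. *)
Record mpair (A : nzRingType) := MPair {
  mdom : set A;
  mfun : A -> A;
  mdomP : nonzero_ideal mdom;
  mfunP : right_linear_on mdom mfun }.

HB.instance Definition _ (A : nzRingType) := gen_eqMixin (mpair A).
HB.instance Definition _ (A : nzRingType) := gen_choiceMixin (mpair A).

Section Martindale.
Variables (K : fieldType) (A : algType K) (pA : prime_ring A).
Implicit Types (p q r : mpair A).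

Definition mequiv p q : bool :=
  `[< exists L : set A, [/\ nonzero_ideal L, L `<=` mdom p `&` mdom q &
        forall x, L x -> mfun p x = mfun q x] >].

Lemma mequiv_refl : reflexive mequiv.
Proof.
by move=> p; apply/asboolP; exists (mdom p); split=> //; exact: mdomP.
Qed.

Lemma mequiv_sym : symmetric mequiv.
Proof.
have h p q : mequiv p q -> mequiv q p.
  move=> /asboolP[L [L0 Ls e]]; apply/asboolP; exists L; split=> //.
    by rewrite setIC.
  by move=> x /e.
by move=> p q; apply/idP/idP; exact: h.
Qed.

Lemma mequiv_trans : transitive mequiv.
Proof.
move=> q p r /asboolP[L [L0 Ls e]] /asboolP[M [M0 Ms e']]; apply/asboolP.
exists (ideal_mul L M); split; first exact: nonzero_ideal_mul.
  move=> x x_; split.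
    by have /Ls[] := ideal_mul_subl L0.1 x_.
  by have /Ms[] := ideal_mul_subr M0.1 x_.
move=> x x_; rewrite e; last by apply: ideal_mul_subl x_; exact: L0.1.
by apply: e'; apply: ideal_mul_subr x_; exact: M0.1.
Qed.

Definition mequiv_rel := EquivRel mequiv mequiv_refl mequiv_sym mequiv_trans.

(* The type depends on pA because transitivity of mequiv uses primeness. *)
Definition martindale := {eq_quot mequiv_rel}.

HB.instance Definition _ := Choice.on martindale.
HB.instance Definition _ := EqQuotient.on martindale.

Lemma mequivP p q : reflect
  (exists L : set A, [/\ nonzero_ideal L, L `<=` mdom p `&` mdom q &
        forall x, L x -> mfun p x = mfun q x])
  (p == q %[mod martindale]).
Proof. by rewrite eqmodE; exact: asboolP. Qed.

(* The zero and unit pairs are left multiplications by 0 and 1. *)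
Fact lmul_right_linear (a : A) : right_linear_on [set: A] ( *%R a).
Proof. by split=> [x y _ _|x b _]; rewrite ?mulrDr ?mulrA. Qed.

Definition mpair_lmul a := MPair (nonzero_idealT A) (lmul_right_linear a).

Fact mpair_add_dom p q : nonzero_ideal (mdom p `&` mdom q).
Proof.
have [[p0 pD pl pr] _] := mdomP p; have [[q0 qD ql qr] _] := mdomP q.
have [i0 n0] := nonzero_ideal_mul pA (mdomP p) (mdomP q).
split; first split=> //.
- by move=> x y [? ?] [? ?]; split; [exact: pD|exact: qD].
- by move=> a x [? ?]; split; [exact: pl|exact: ql].
- by move=> a x [? ?]; split; [exact: pr|exact: qr].
move=> e; apply: n0; apply/seteqP; split; last by move=> _ ->; case: i0.
move=> x x_; rewrite -e; split.
  by apply: ideal_mul_subl x_; exact: (mdomP p).1.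
by apply: ideal_mul_subr x_; exact: (mdomP q).1.
Qed.

Fact mpair_add_fun p q :
  right_linear_on (mdom p `&` mdom q) (fun x => mfun p x + mfun q x).
Proof.
have [pD pM] := mfunP p; have [qD qM] := mfunP q; split.
  by move=> x y [? ?] [? ?]; rewrite pD // qD // addrACA.
by move=> x a [? ?]; rewrite pM // qM // mulrDl.
Qed.

Definition mpair_add p q := MPair (mpair_add_dom p q) (mpair_add_fun p q).

Fact mpair_scale_fun (k : K) p :
  right_linear_on (mdom p) (fun x => k *: mfun p x).
Proof.
have [pD pM] := mfunP p; split=> [x y ? ?|x a ?]; first by rewrite pD // scalerDr.
by rewrite pM // scalerAl.
Qed.

Definition mpair_scale k p := MPair (mdomP p) (mpair_scale_fun k p).

Fact mpair_mul_fun p q :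
  right_linear_on (ideal_mul (mdom q) (mdom p)) (fun x => mfun p (mfun q x)).
Proof.
have [pD pM] := mfunP p; have [qD qM] := mfunP q.
have [ip _] := mdomP p; have [iq _] := mdomP q.
have h := right_linear_mul iq ip (mfunP q) (@subset_refl _ (mdom q)).
have h' := @ideal_mul_subl _ _ (mdom p) iq.
split=> [x y x_ y_|x a x_].
  by rewrite (qD _ _ (h' _ x_) (h' _ y_)) pD //; exact: h.
by rewrite (qM _ _ (h' _ x_)) pM //; exact: h.
Qed.

Definition mpair_mul p q :=
  MPair (nonzero_ideal_mul pA (mdomP q) (mdomP p)) (mpair_mul_fun p q).

Lemma mequiv_of_fun p q : mfun p =1 mfun q -> p = q %[mod martindale].
Proof.
move=> e; apply/eqP/mequivP; exists (mdom p `&` mdom q).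
by split=> //; exact: mpair_add_dom.
Qed.

Definition mlmul (a : A) : martindale := \pi_martindale (mpair_lmul a).
Definition madd (u v : martindale) : martindale :=
  \pi_martindale (mpair_add (repr u) (repr v)).
Definition mscale k (u : martindale) : martindale := \pi_martindale (mpair_scale k (repr u)).
Definition mmul (u v : martindale) : martindale :=
  \pi_martindale (mpair_mul (repr u) (repr v)).

Lemma mscale_pi k p : mscale k (\pi_martindale p) = \pi_martindale (mpair_scale k p).
Proof.
apply/eqP/mequivP.
have /mequivP[L [L0 Ls e]] : repr (\pi_martindale p) == p %[mod martindale].
  by rewrite reprK.
by exists L; split=> // x /e /= ->.
Qed.

Lemma madd_pi p q : madd (\pi_martindale p) (\pi_martindale q) = \pi_martindale (mpair_add p q).
Proof.
apply/eqP/mequivP.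
have /mequivP[L [L0 Ls e]] : repr (\pi_martindale p) == p %[mod martindale].
  by rewrite reprK.
have /mequivP[M [M0 Ms e']] : repr (\pi_martindale q) == q %[mod martindale].
  by rewrite reprK.
have hL := @ideal_mul_subl _ _ M L0.1; have hM := @ideal_mul_subr _ L _ M0.1.
exists (ideal_mul L M); split; first exact: nonzero_ideal_mul.
  by move=> x x_; have [? ?] := Ls _ (hL _ x_); have [? ?] := Ms _ (hM _ x_).
by move=> x x_ /=; rewrite e ?e' //; [exact: hM|exact: hL].
Qed.

Lemma mmul_pi p q : mmul (\pi_martindale p) (\pi_martindale q) = \pi_martindale (mpair_mul p q).
Proof.
apply/eqP/mequivP.
have /mequivP[L [L0 Ls e]] : repr (\pi_martindale p) == p %[mod martindale].
  by rewrite reprK.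
have /mequivP[M [M0 Ms e']] : repr (\pi_martindale q) == q %[mod martindale].
  by rewrite reprK.
exists (ideal_mul M L); split; first exact: nonzero_ideal_mul.
  by move=> x x_; split; apply: ideal_mulS x_ => y; [move=> /Ms[]|move=> /Ls[]
    |move=> /Ms[]|move=> /Ls[]].
move=> x x_ /=; rewrite e'; last by apply: ideal_mul_subl x_; exact: M0.1.
rewrite e //; apply: right_linear_mul x_; [|exact: L0.1|exact: mfunP|].
  exact: (mdomP q).1.
by move=> y /Ms[].
Qed.

Lemma martindaleW (P : martindale -> Prop) :
  (forall p, P (\pi_martindale p)) -> forall u, P u.
Proof. exact: quotW. Qed.

Fact maddA : associative madd.
Proof.
elim/martindaleW=> p; elim/martindaleW=> q; elim/martindaleW=> r; rewrite (madd_pi q r) (madd_pi p q) !madd_pi.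
by apply: mequiv_of_fun => x /=; rewrite addrA.
Qed.

Fact maddC : commutative madd.
Proof.
elim/martindaleW=> p; elim/martindaleW=> q; rewrite !madd_pi.
by apply: mequiv_of_fun => x /=; rewrite addrC.
Qed.

Fact madd0 : left_id (mlmul 0) madd.
Proof.
elim/martindaleW=> p; rewrite madd_pi.
by apply: mequiv_of_fun => x /=; rewrite mul0r add0r.
Qed.

Fact maddN : left_inverse (mlmul 0) (mscale (-1)) madd.
Proof.
elim/martindaleW=> p; rewrite mscale_pi madd_pi.
by apply: mequiv_of_fun => x /=; rewrite scaleN1r addNr mul0r.
Qed.

HB.instance Definition _ :=
  GRing.isZmodule.Build martindale maddA maddC madd0 maddN.

Fact mmulA : associative mmul.
Proof.
elim/martindaleW=> p; elim/martindaleW=> q; elim/martindaleW=> r; rewrite (mmul_pi q r) (mmul_pi p q) !mmul_pi.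
by apply: mequiv_of_fun.
Qed.

Fact mmul1l : left_id (mlmul 1) mmul.
Proof.
elim/martindaleW=> p; rewrite mmul_pi.
by apply: mequiv_of_fun => x /=; rewrite mul1r.
Qed.

Fact mmul1r : right_id (mlmul 1) mmul.
Proof.
elim/martindaleW=> p; rewrite mmul_pi.
by apply: mequiv_of_fun => x /=; rewrite mul1r.
Qed.

Fact mmulDl : left_distributive mmul madd.
Proof.
elim/martindaleW=> p; elim/martindaleW=> q; elim/martindaleW=> r; rewrite (madd_pi p q) (mmul_pi p r) (mmul_pi q r) mmul_pi madd_pi.
by apply: mequiv_of_fun.
Qed.

Fact mmulDr : right_distributive mmul madd.
Proof.
elim/martindaleW=> p; elim/martindaleW=> q; elim/martindaleW=> r; rewrite (madd_pi q r) (mmul_pi p q) (mmul_pi p r) mmul_pi madd_pi.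
apply/eqP/mequivP; set s := mpair_mul _ _; set t := mpair_add _ _.
have iqr := mpair_add_dom q r; have ip := mdomP p.
exists (ideal_mul (mdom q `&` mdom r) (mdom p)); split.
- exact: nonzero_ideal_mul.
- by move=> x x_; split=> //; split; apply: ideal_mulS x_ => y // [].
- move=> x x_ /=; have [pD _] := mfunP p; rewrite pD //.
    by apply: (right_linear_mul _ ip.1 (mfunP q) _ x_) => [|y []//];
      exact: (mdomP q).1.
  by apply: (right_linear_mul _ ip.1 (mfunP r) _ x_) => [|y []//];
    exact: (mdomP r).1.
Qed.

Fact mone_neq0 : mlmul 1 != 0.
Proof.
apply/negP => /mequivP[L [[[L0 _ _ _] nL] _ e]]; apply: nL.
apply/seteqP; split=> [x /e /=|_ -> //]; by rewrite mul1r mul0r.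
Qed.

HB.instance Definition _ := GRing.Zmodule_isNzRing.Build martindale
  mmulA mmul1l mmul1r mmulDl mmulDr mone_neq0.

Fact mscaleA k l u : mscale k (mscale l u) = mscale (k * l) u.
Proof.
elim/martindaleW: u => p; rewrite (mscale_pi l p) !mscale_pi.
by apply: mequiv_of_fun => x /=; rewrite scalerA.
Qed.

Fact mscale1 : left_id 1 mscale.
Proof.
elim/martindaleW=> p; rewrite mscale_pi.
by apply: mequiv_of_fun => x /=; rewrite scale1r.
Qed.

Fact mscaleDr : right_distributive mscale +%R.
Proof.
move=> k; elim/martindaleW=> p; elim/martindaleW=> q.
rewrite -[X in mscale _ X = _]/(madd _ _) -[RHS]/(madd _ _) (madd_pi p q) (mscale_pi k p) (mscale_pi k q) mscale_pi madd_pi.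
by apply: mequiv_of_fun => x /=; rewrite scalerDr.
Qed.

Fact mscaleDl u : {morph mscale^~ u : k l / k + l}.
Proof.
move=> k l; elim/martindaleW: u => p; rewrite -[RHS]/(madd _ _) (mscale_pi k p) (mscale_pi l p) mscale_pi madd_pi.
by apply: mequiv_of_fun => x /=; rewrite scalerDl.
Qed.

HB.instance Definition _ := GRing.Zmodule_isLmodule.Build K martindale
  mscaleA mscale1 mscaleDr mscaleDl.

Fact mscaleAl k (u v : martindale) : k *: (u * v) = k *: u * v.
Proof.
rewrite -[LHS]/(mscale k (mmul u v)) -[RHS]/(mmul (mscale k u) v).
elim/martindaleW: u => p; elim/martindaleW: v => q; rewrite (mmul_pi p q) (mscale_pi k p) mscale_pi mmul_pi.
by apply: mequiv_of_fun.
Qed.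

HB.instance Definition _ := GRing.Lmodule_isLalgebra.Build K martindale mscaleAl.

Fact mscaleAr k (u v : martindale) : k *: (u * v) = u * (k *: v).
Proof.
rewrite -[LHS]/(mscale k (mmul u v)) -[RHS]/(mmul u (mscale k v)).
elim/martindaleW: u => p; elim/martindaleW: v => q; rewrite (mmul_pi p q) (mscale_pi k q) mscale_pi mmul_pi.
apply/eqP/mequivP; exists (ideal_mul (mdom q) (mdom p)); split.
- exact: nonzero_ideal_mul (mdomP q) (mdomP p).
- by [].
- move=> x x_ /=; have [_ pM] := mfunP p.
  rewrite -(mulr_algr k (mfun q x)) pM ?mulr_algr //.
  apply: right_linear_mul x_; [|exact: (mdomP p).1|exact: mfunP|by []].
  exact: (mdomP q).1.
Qed.

HB.instance Definition _ := GRing.Lalgebra_isAlgebra.Build K martindale mscaleAr.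

(* The K-algebra structure is the one induced by K -> A -> martindale. *)
Lemma in_alg_martindale k : in_alg martindale k = mlmul (in_alg A k).
Proof.
rewrite -[LHS]/(mscale k (\pi_martindale _)) mscale_pi; apply: mequiv_of_fun => x /=.
by rewrite mul1r -scalerAl mul1r.
Qed.

Definition extended_centre : set martindale :=
  [set z | forall u : martindale, z * u = u * z].

End Martindale.

Definition algebraic_elt (K : fieldType) (B : algType K) (z : B) : Prop :=
  exists p : {poly K}, p != 0 /\ horner_alg z p = 0.

(* Main.v *)
From HB Require Import structures.
From mathcomp Require Import all_boot all_order all_algebra perm generic_quotient.
From mathcomp Require Import boolp classical_sets cardinality reals.
From mathcomp Require Import zify monalg.
Require Import Defs.

(** Let z be an element of the extended centre that is transcendental over K;
the claim is that A then satisfies a standard identity.  Write F for the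
extended centre, a field, and B for the F-algebra F A inside the Martindale
ring.  Fix a finite-dimensional generating space V of A containing 1, and say
that x has depth k in degree n when z^i x lies in V^n for all i <= k.  If
x_1, ..., x_r of depth k in degree n are linearly independent over F, then the
(k + 1) r elements z^i x_j of V^n are independent over K, because a nonzero
polynomial in z is an invertible scalar of F.  Quadratic growth therefore gives
(k + 1) r <= C n^2 [depth_dim].  Depths and degrees add up under products, and
elements of depth 1 exist: any nonzero a in an ideal on which z acts as a map
into A.  Together with primeness, this bound is all that is used
of A; [deep_growth_PI] states it for an abstract family G k n of elements of
depth k in degree n.

The algebra B is prime, like A; suppose that it is not PI.  Then a nonzero
right ideal of B is infinite-dimensional over F [rideal_infinite].  Hence if
all the rows V^i x B / V^(i-1) x B are infinite-dimensional, then
V^n x V^n has dimension at least n^2, for an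
n that may be taken large with respect to the degree of x, and with a constant
independent of x.  If x has depth m > 9 C this contradicts the bound.  So some
row V^(i+1) x B / V^i x B is finite-dimensional: with X = V^i x, the right
ideal X B is a left ideal up to finite-dimensional errors, and primeness then
prevents X from being nilpotent [stable_row_not_nilpotent].

Since X^n has depth n in a degree linear in n, the bound says that spaces such
as X^n V^n have dimension O(n).  It follows that X^a B / X^(a+1) B is
finite-dimensional for some a, and then, by expanding repeatedly and cutting
into dyadic blocks, that X^a V^n itself has dimension O(n) for n = 2^p
[rk_expand].  So B contains right ideals y B with dim (y V^n) <= c n + c0 for
infinitely many n; for the least such c the right ideal y B is critical, that
is, all its proper quotients are finite-dimensional [critical], and therefore
left multiplication by u in y B is injective on y B as soon as u y <> 0.

If one such u is transcendental, then y B is a torsion-free F[u]-module, of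
finite rank by linear growth, on which B acts faithfully; B embeds in matrices
over F(u) and is PI [transcendental_PI].  Otherwise every u is algebraic, hence
invertible on y B, so y B = f B is a minimal right ideal with f idempotent, and
f B f is a division algebra, algebraic over F.  Linear growth bounds the degree
of its subfields, a maximal subfield is its own centralizer, and a Dedekind
independence argument shows that f B f is finite-dimensional [corner_finite].
Finally f = f^k has every depth, so one of its rows is finite-dimensional;
because f B is simple and infinite-dimensional, V^i f B is then a left ideal,
B f lies in V^i f B f, and B acts faithfully on a finite-dimensional left
ideal.  So B is finite-dimensional, and PI after all. *)

Set Implicit Arguments.
Unset Strict Implicit.
Unset Printing Implicit Defensive.

Import Order.TTheory GRing.Theory Num.Theory.

Local Open Scope classical_set_scope.
Local Open Scope quotient_scope.
Local Open Scope ring_scope.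

(** * Spans and ranks of finite lists *)

Section Span.
Variables (F : fieldType) (Q : algType F).
Implicit Types (W P : set Q) (s t u : seq Q) (x y z : Q).

Definition is_subspace W := W 0 /\ forall (a : F) x y, W x -> W y -> W (a *: x + y).

Lemma subsp0 W : is_subspace W -> W 0. Proof. by case. Qed.
Lemma subspD W x y : is_subspace W -> W x -> W y -> W (x + y).
Proof. by case=> _ h wx wy; rewrite -[x]scale1r; exact: h. Qed.
Lemma subspZ W (a : F) x : is_subspace W -> W x -> W (a *: x).
Proof. by case=> h0 h wx; rewrite -[_ *: _]addr0; exact: h. Qed.
Lemma subspN W x : is_subspace W -> W x -> W (- x).
Proof. by rewrite -scaleN1r; exact: subspZ. Qed.
Lemma subspB W x y : is_subspace W -> W x -> W y -> W (x - y).
Proof. by move=> h wx wy; apply: subspD => //; exact: subspN. Qed.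
Lemma subsp_sum W (I : Type) (r : seq I) (p : pred I) (E : I -> Q) : is_subspace W ->
  (forall i, p i -> W (E i)) -> W (\sum_(i <- r | p i) E i).
Proof.
by move=> h hE; apply: (big_ind W) => //; [exact: subsp0|move=> *; exact: subspD].
Qed.

Definition zero_sp : set Q := [set 0].

Lemma subsp_zero : is_subspace zero_sp.
Proof. by split=> // a x y -> ->; rewrite scaler0 addr0. Qed.

Lemma subsp_mull a W : is_subspace W -> is_subspace [set x | W (a * x)].
Proof.
move=> [h0 h]; split=> [|c x y] /=; rewrite ?mulr0 // mulrDr -scalerAr.
exact: h.
Qed.

Lemma subsp_mulr a W : is_subspace W -> is_subspace [set x | W (x * a)].
Proof.
move=> [h0 h]; split=> [|c x y] /=; rewrite ?mul0r // mulrDl -scalerAl.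
exact: h.
Qed.

(** The sum of the subspace W and of the span of the list.  Working modulo W
    lets all dimension counts be made in quotients of Q without forming them. *)
Fixpoint span_mod W s : set Q :=
  if s is x :: s' then [set y | exists c : F, span_mod W s' (y - c *: x)] else W.

Notation sp := (span_mod zero_sp).

Lemma spn_subsp W s : is_subspace W -> is_subspace (span_mod W s).
Proof.
move=> hW; elim: s => [|x s IH] //=; split=> [|a y z [c hc] [d hd]] /=.
  by exists 0; rewrite scale0r subr0; exact: subsp0.
exists (a * c + d); case: IH => _ /(_ a _ _ hc hd).
by rewrite scalerDl -scalerA scalerBr opprD addrACA.
Qed.

Lemma spn_base W s x : W x -> span_mod W s x.
Proof. by elim: s x => //= y s IH x Wx; exists 0; rewrite scale0r subr0;
  exact: IH. Qed.

Lemma spn_mem W s x : is_subspace W -> x \in s -> span_mod W s x.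
Proof.
move=> hW; elim: s => //= y s IH; rewrite inE => /predU1P[->|xs].
  by exists 1; rewrite scale1r subrr; apply: subsp0; exact: spn_subsp.
by exists 0; rewrite scale0r subr0; exact: IH.
Qed.

Lemma spn_min W s P x : is_subspace P -> W `<=` P -> (forall y, y \in s -> P y) ->
  span_mod W s x -> P x.
Proof.
move=> hP hW; elim: s x => [x _|y s IH x hs /= [c hc]]; first exact: hW.
rewrite -(subrK (c *: y) x); apply: subspD => //.
  by apply: IH hc => z zs; apply: hs; rewrite inE zs orbT.
by apply: subspZ => //; apply: hs; rewrite inE eqxx.
Qed.

Lemma spn_sub W W' s t x : is_subspace W' -> W `<=` span_mod W' t ->
  (forall y, y \in s -> span_mod W' t y) -> span_mod W s x -> span_mod W' t x.
Proof. by move=> hW' hW hs; apply: spn_min => //; exact: spn_subsp. Qed.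

Lemma sp_sub W t s x : is_subspace W ->
  (forall y, y \in s -> span_mod W t y) -> sp s x -> span_mod W t x.
Proof.
move=> hW; apply: spn_sub => // _ ->; apply: subsp0; exact: spn_subsp.
Qed.

Lemma spn_cat W s t : span_mod W (s ++ t) = span_mod (span_mod W t) s.
Proof. by elim: s => //= x s ->. Qed.

Lemma spnS W W' s t x : is_subspace W' -> W `<=` W' -> {subset s <= t} ->
  span_mod W s x -> span_mod W' t x.
Proof.
move=> hW' sW st; apply: spn_sub => // [y /sW Wy|y ys]; first exact: spn_base.
by apply: spn_mem => //; exact: st.
Qed.

Lemma spn_coef W s x : span_mod W s x ->
  exists c : 'I_(size s) -> F, W (x - \sum_i c i *: s`_i).
Proof.
elim: s x => [x Wx|y s IH x /= [c /IH[d hd]]].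
  by exists (fun=> 0); rewrite big_ord0 subr0.
exists (fun i => if unlift ord0 i is Some j then d j else c).
rewrite big_ord_recl unlift_none /= opprD addrA.
under eq_bigr do rewrite liftK.
by [].
Qed.

Lemma sp_coef s x : sp s x ->
  exists c : 'I_(size s) -> F, x = \sum_i c i *: s`_i.
Proof. by case/spn_coef=> c /eqP; rewrite subr_eq0 => /eqP; exists c. Qed.

Lemma spn_sum W s (I : finType) (c : I -> F) (v : I -> Q) : is_subspace W ->
  (forall i, v i \in s) -> span_mod W s (\sum_i c i *: v i).
Proof.
move=> hW hv; apply: subsp_sum => [|i _]; first exact: spn_subsp.
by apply: subspZ; [exact: spn_subsp|exact: spn_mem].
Qed.

(** Linear independence of the list in Q / W, in triangular form: each entry
    avoids the span of those after it. *)
Fixpoint indep_mod W s : Prop :=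
  if s is x :: s' then ~ span_mod W s' x /\ indep_mod W s' else True.

Lemma indep_cat W s t : indep_mod W (s ++ t) <->
  indep_mod W t /\ indep_mod (span_mod W t) s.
Proof.
elim: s => [|x s IH] /=; first by split=> [|[]].
by rewrite spn_cat; split=> [[h1 /IH[h2 h3]]|[h1 [h2 h3]]] //; split=> //; apply/IH.
Qed.

Lemma indepW W W' s : is_subspace W -> W' `<=` W -> indep_mod W s -> indep_mod W' s.
Proof.
move=> hW sW; elim: s => //= x s IH [h1 /IH h2]; split=> // h; apply: h1.
by apply: spnS h.
Qed.

Lemma indep_coef W s : is_subspace W -> indep_mod W s -> forall c : 'I_(size s) -> F,
  W (\sum_i c i *: s`_i) -> forall i, c i = 0.
Proof.
move=> hW; elim: s => [_ c _ []//|x s IH /= [hx hs] c].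
rewrite big_ord_recl /= => hc.
have c0 : c ord0 = 0.
  apply/eqP; apply: contrapT => /negP nz; apply: hx.
  have : span_mod W s (c ord0 *: x).
    set y := (X in W (_ + X)) in hc.
    rewrite -(addrK y (_ *: x)); apply: subspB; first exact: spn_subsp.
      exact: spn_base.
    apply: (@spn_sum W s _ (fun i => c (lift ord0 i)) (fun i => s`_i)) => // i.
    by rewrite mem_nth.
  move=> /(subspZ (c ord0)^-1 (spn_subsp s hW)).
  by rewrite scalerA mulVf // scale1r.
move: hc; rewrite c0 scale0r add0r => /(IH hs) h i.
by case: (unliftP ord0 i) => [j|] ->.
Qed.

(** The coefficients are indexed by nat so that the criterion applies to lists
    whose size is only propositionally known. *)
Lemma coef_indep W s : is_subspace W ->
  (forall c : nat -> F, W (\sum_(i < size s) c i *: s`_i) ->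
     forall i, (i < size s)%N -> c i = 0) -> indep_mod W s.
Proof.
move=> hW; elim: s => //= x s IH h; split; last first.
  apply: IH => c hc i iS; have := h (fun i =>
    if i is j.+1 then c j else 0) _ i.+1 iS.
  by apply; rewrite big_ord_recl /= scale0r add0r.
move=> /spn_coef[c hc]; pose d i := if insub i is Some j then c j else 0.
have := h (fun i => if i is j.+1 then - d j else 1) _ 0%N isT.
rewrite big_ord_recl /= scale1r => /(_ _)/eqP; rewrite oner_eq0 => /(_ _)/negP;
  apply => //.
rewrite -sumrN in hc; congr (W (_ + _)): hc; apply: eq_bigr => i _.
by rewrite /d valK scaleNr.
Qed.

(** Steinitz: a list longer than t would have a dependent matrix of coordinates
    on t. *)
Lemma indep_size W s t : is_subspace W -> indep_mod W s ->
  (forall x, x \in s -> span_mod W t x) -> (size s <= size t)%N.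
Proof.
move=> hW hs hst; rewrite leqNgt; apply/negP => lt.
have /choice[M hM] : forall i : 'I_(size s), exists c : 'I_(size t) -> F,
    W (s`_i - \sum_j c j *: t`_j).
  by move=> i; apply: spn_coef; apply: hst; rewrite mem_nth.
pose A := \matrix_(i, j) M i j.
have /rowV0Pn[v /sub_kermxP vA v0] : kermx A != 0.
  rewrite kermx_eq0 /row_free; apply: contraL lt => /eqP <-.
  by rewrite -leqNgt rank_leq_col.
case/negP: v0; apply/eqP/rowP => i; rewrite mxE.
apply: (indep_coef hW hs (c := fun i => v 0 i)) => {i}.
have -> : \sum_i v 0 i *: s`_i =
    \sum_i v 0 i *: (s`_i - \sum_j M i j *: t`_j).
  rewrite -[LHS]subr0 -[in RHS](eq_bigr _ (fun i _ => esym (scalerBr _ _ _))).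
  rewrite sumrB; congr (_ - _); apply/esym.
  under eq_bigr do rewrite scaler_sumr.
  rewrite exchange_big /= big1 // => j _.
  under eq_bigr do rewrite scalerA.
  rewrite -scaler_suml; have /rowP/(_ j) := vA; rewrite !mxE => h.
  rewrite -[X in X *: _ = _]/(\sum_i _) (eq_bigr (fun i => v 0 i * A i j)).
    by rewrite h scale0r.
  by move=> i _; rewrite mxE.
by apply: subsp_sum => // i _; exact: subspZ.
Qed.

(** The dimension of the image of the span of the list in Q / W. *)
Fixpoint rank_mod W s : nat :=
  if s is x :: s' then (rank_mod W s' + `[< ~ span_mod W s' x >])%N else 0%N.

Lemma rk_basis W s : is_subspace W -> exists t, [/\ {subset t <= s}, indep_mod W t,
  size t = rank_mod W s & forall x, span_mod W s x -> span_mod W t x].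
Proof.
move=> hW; elim: s => [|x s [t [ts it st hst]]]; first by exists [::].
have tS y : y \in t -> y \in x :: s by move=> /ts yt; rewrite inE yt orbT.
case: (EM (span_mod W s x)) => h /=.
  exists t; split=> //; first by rewrite asboolF // addn0.
  move=> y [c /hst hc]; rewrite -(subrK (c *: x) y).
  apply: subspD => //; first exact: spn_subsp.
  by apply: subspZ; [exact: spn_subsp|exact: hst].
exists (x :: t); split=> /=.
- by move=> y; rewrite inE => /predU1P[->|/tS//]; rewrite inE eqxx.
- by split=> // h'; apply: h; apply: spnS h'.
- by rewrite asboolT //= addn1 st.
- by move=> y [c /hst]; exists c.
Qed.

Lemma indep_rk W s t : is_subspace W -> indep_mod W s ->
  (forall x, x \in s -> span_mod W t x) -> (size s <= rank_mod W t)%N.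
Proof.
move=> hW hs h; have [b [_ _ <- hb]] := rk_basis t hW.
by apply: (indep_size hW hs) => x /h/hb.
Qed.

Lemma rk_le W s t : is_subspace W -> (forall x, x \in s -> span_mod W t x) ->
  (rank_mod W s <= rank_mod W t)%N.
Proof.
move=> hW h; have [b [bs ib <- hb]] := rk_basis s hW.
by apply: indep_rk => // x /bs/h.
Qed.

Lemma rk_cat W s t : is_subspace W ->
  (rank_mod W (s ++ t) <= rank_mod W s + rank_mod W t)%N.
Proof.
move=> hW; elim: s => [|x s IH] //=; rewrite addnAC leq_add //.
case: (EM (span_mod W s x)) => h; last by rewrite (asboolT h) leq_b1.
rewrite asboolF // => /(_ _)[]; apply: spnS h => // y ys.
by rewrite mem_cat ys.
Qed.

Lemma indep_rkE W s : indep_mod W s -> rank_mod W s = size s.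
Proof. by elim: s => //= x s IH [h /IH->]; rewrite asboolT // addn1. Qed.

Definition products s t := [seq x * y | x <- s, y <- t].

Lemma mem_products s t x y : x \in s -> y \in t -> x * y \in products s t.
Proof. by move=> xs yt; apply/allpairsP; exists (x, y). Qed.

Lemma products_ind s t (P : Q -> Prop) : (forall x y, x \in s -> y \in t ->
  P (x * y)) ->
  forall z, z \in products s t -> P z.
Proof. by move=> h z /allpairsP[[x y] /= [xs yt ->]]; exact: h. Qed.

Lemma sp_products_ind W s t x y : is_subspace W ->
  (forall x y, x \in s -> y \in t -> W (x * y)) -> sp s x -> sp t y -> W (x * y).
Proof.
move=> hW h hx hy; have {}h z : z \in s -> W (z * y).
  move=> zs; apply: (spn_min (subsp_mull z hW) _ _ hy) => [_ ->|w wt] /=.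
    by rewrite mulr0; exact: subsp0.
  exact: h.
apply: (spn_min (subsp_mulr y hW) _ h hx) => _ -> /=.
by rewrite mul0r; exact: subsp0.
Qed.

Lemma sp_products s t x y : sp s x -> sp t y -> sp (products s t) (x * y).
Proof.
apply: sp_products_ind; first exact/spn_subsp/subsp_zero.
by move=> ? ? ? ?; apply: spn_mem; [exact: subsp_zero|exact: mem_products].
Qed.

Fixpoint monomials s n := if n is n'.+1 then products s (monomials s n') else [:: 1].

Lemma monomialsD s m n x y : x \in monomials s m -> y \in monomials s n ->
  x * y \in monomials s (m + n).
Proof.
elim: m x => [|m IH] x; first by rewrite inE => /eqP->; rewrite mul1r.
move=> /allpairsP[[a b] /= [sa sb ->]] yn; rewrite -mulrA.
by apply: mem_products => //; exact: IH.
Qed.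

Lemma monomials_split s m n z : z \in monomials s (m + n) ->
  exists x y, [/\ x \in monomials s m, y \in monomials s n & z = x * y].
Proof.
elim: m z => [|m IH] z /=; first by move=> zn; exists 1, z; rewrite inE eqxx mul1r.
move=> /allpairsP[[a b] /= [sa /IH[x [y [xm yn ->]]] ->]].
by exists (a * x), y; rewrite mulrA mem_products.
Qed.

Lemma monomials1 s x : (x \in monomials s 1) = (x \in s).
Proof.
apply/idP/idP=> [/allpairsP[[a b] /= [sa]]|xs].
  by rewrite inE => /eqP-> ->; rewrite mulr1.
by rewrite -[x]mulr1; apply: mem_products; rewrite ?inE.
Qed.

Lemma monomials_mono s m n x : 1 \in s -> (m <= n)%N -> x \in monomials s m ->
  x \in monomials s n.
Proof.
move=> s1 /subnK<-; elim: (n - m)%N => // k IH /IH h.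
by rewrite addSn -[x]mul1r; apply: mem_products.
Qed.

Lemma monomials_one s n : 1 \in s -> 1 \in monomials s n.
Proof. by move=> s1; apply: (monomials_mono s1 (leq0n n)); rewrite inE. Qed.

End Span.
Arguments zero_sp {F Q}.
Arguments subsp_zero {F Q}.

(** * The standard polynomial *)

Definition stdpoly (S : nzRingType) N (b : 'I_N -> S) : S :=
  \sum_(s : 'S_N) (-1) ^+ s * \prod_(i < N) b (s i).

Lemma prod_scale (R : comNzRingType) (S : algType R) (I : Type) (r : seq I)
    (c : I -> R) (e : I -> S) :
  \prod_(i <- r) (c i *: e i) = (\prod_(i <- r) c i) *: \prod_(i <- r) e i.
Proof.
elim: r => [|i r IH]; first by rewrite !big_nil scale1r.
by rewrite !big_cons IH -scalerAl -scalerAr scalerA.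
Qed.

Lemma sign_scale (R : comNzRingType) (S : algType R) (b : bool) (x : S) :
  (-1) ^+ b * x = ((-1) ^+ b : R) *: x.
Proof. by case: b; rewrite ?mulN1r ?scaleN1r // mul1r scale1r. Qed.

(** Expanding in coordinates, the coefficient of a word e_(g 0) ... e_(g (N-1))
    is a determinant with entries c j (g i); as g cannot be injective, two of its
    rows agree. *)
Lemma stdpoly_spanned (R : comNzRingType) (S : algType R) (I : finType) N
    (e : I -> S) (c : 'I_N -> I -> R) : (#|I| < N)%N ->
  stdpoly (fun i => \sum_k c i k *: e k) = 0.
Proof.
move=> lt; rewrite /stdpoly.
under eq_bigr => s _.
  rewrite (bigA_distr_bigA (fun i k => c (s i) k *: e k)) /= mulr_sumr.
  under eq_bigr => g _ do rewrite prod_scale sign_scale scalerA.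
over.
rewrite exchange_big big1 //= => g _; rewrite -scaler_suml.
have /injectivePn[i [j ij gij]] : ~~ injectiveb g.
  apply/injectiveP=> inj; have := leq_card g inj.
  by rewrite card_ord leqNgt lt.
pose M := \matrix_(i, j) c j (g i).
rewrite (_ : \sum_s _ = \det M); last first.
  by apply: eq_bigr => s _; congr (_ * _); apply: eq_bigr => k _; rewrite mxE.
by rewrite (determinant_alternate ij) ?scale0r // => k; rewrite !mxE gij.
Qed.

Lemma stdpoly_mx (R : comNzRingType) n N (P : 'I_N -> 'M[R]_n.+1) :
  (n.+1 * n.+1 < N)%N -> stdpoly P = 0.
Proof.
move=> lt.
have := @stdpoly_spanned R _ ('I_n.+1 * 'I_n.+1)%type N
  (fun k => delta_mx k.1 k.2) (fun i k => P i k.1 k.2).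
rewrite card_prod card_ord => /(_ lt) <-; congr stdpoly; apply/funext => i.
by rewrite [LHS]matrix_sum_delta pair_bigA.
Qed.

Section MatrixAction.
Variables (F : fieldType) (Q : algType F).

(** Here B acts on the right of the F[X]-module generated by the m i through
    matrices with a common denominator.  Since scalars act on the other side and
    commute with each other, the standard polynomial acts through its value on
    n+1 by n+1 matrices over a commutative ring, which is 0. *)
Lemma stdpoly_rep (B : set Q) (ev : {rmorphism {poly F} -> Q}) n (m : 'I_n.+1 -> Q) :
  (forall b, B b -> exists (p : {poly F}) (P : 'M[{poly F}]_n.+1), p != 0 /\
     forall i, ev p * m i * b = \sum_j ev (P i j) * m j) ->
  forall N (b : 'I_N -> Q), (n.+1 * n.+1 < N)%N -> (forall i, B (b i)) ->
  exists p : {poly F}, p != 0 /\ forall i, ev p * m i * stdpoly b = 0.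
Proof.
move=> h N b lt Bb.
have /choice[p /choice[P /all_and2[p0 hP]]] i := h _ (Bb i).
have evC x y : ev x * ev y = ev y * ev x by rewrite -!rmorphM mulrC.
have word (r : seq 'I_N) i : ev (\prod_(k <- r) p k) * m i * \prod_(k <- r) b k =
    \sum_j ev ((\prod_(k <- r) P k) i j) * m j.
  elim: r i => [|k r IH] i.
    rewrite !big_nil rmorph1 mul1r mulr1 (bigD1 i) //= mxE eqxx rmorph1 mul1r.
    by rewrite big1 ?addr0 // => j /negPf ji; rewrite mxE eq_sym ji rmorph0 mul0r.
  rewrite !big_cons; set pr := \prod_(_ <- r) p _; set br := \prod_(_ <- r) b _.
  transitivity (ev pr * (ev (p k) * m i * b k) * br).
    by rewrite mulrC rmorphM !mulrA.
  rewrite hP mulr_sumr mulr_suml.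
  transitivity (\sum_j ev (P k i j) * (ev pr * m j * br)).
    by apply: eq_bigr => j _; rewrite !mulrA [ev pr * _]evC.
  under [LHS]eq_bigr do rewrite /pr /br IH mulr_sumr.
  rewrite exchange_big; apply: eq_bigr => l _ /=.
  under eq_bigr do rewrite mulrA -rmorphM.
  by rewrite -mulr_suml -rmorph_sum mxE.
exists (\prod_k p k); split; first by apply/prodf_neq0.
move=> i; rewrite /stdpoly mulr_sumr.
transitivity (\sum_j ev (stdpoly P i j) * m j); last first.
  by rewrite stdpoly_mx // big1 // => j _; rewrite mxE rmorph0 mul0r.
under [RHS]eq_bigr => j _.
  rewrite /stdpoly summxE rmorph_sum mulr_suml.
over.
rewrite exchange_big; apply: eq_bigr => s _ /=.
have := word (map s (index_enum 'I_N)) i; rewrite !big_map.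
move=> w; have e : \prod_k p (s k) = \prod_k p k.
  by rewrite [RHS](reindex_inj (@perm_inj _ s)).
rewrite [X in ev X]e in w.
have -> x : (-1) ^+ s * x = x * (-1) ^+ s :> Q by case: (odd_perm s);
  rewrite ?mulN1r ?mulrN1 ?mul1r ?mulr1.
rewrite mulrA w mulr_suml; apply: eq_bigr => j _.
case: (odd_perm s); rewrite ?mulN1r ?mul1r ?mulr1 // mulrN1.
by rewrite mxE rmorphN mulNr.
Qed.
End MatrixAction.

(** * Finitely generated subalgebras and their right ideals *)

Lemma dependent_rows (F : fieldType) (I : finType) M (c : 'I_M -> I -> F) :
  (#|I| < M)%N -> exists v : 'I_M -> F,
    (exists m, v m != 0) /\ forall i, \sum_m v m * c m i = 0.
Proof.
move=> lt; pose A := \matrix_(m < M, l < #|I|) c m (enum_val l).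
have /rowV0Pn[v /sub_kermxP vA v0] : kermx A != 0.
  rewrite kermx_eq0 /row_free; apply: contraL lt => /eqP <-.
  by rewrite -leqNgt rank_leq_col.
exists (v 0); split.
  apply: contrapT => h; case/negP: v0; apply/eqP/rowP => m; rewrite mxE.
  by apply/eqP; apply: contrapT => /negP vm; apply: h; exists m.
move=> i; have /rowP/(_ (enum_rank i)) := vA; rewrite !mxE => e.
by rewrite -[RHS]e; apply: eq_bigr => m _; rewrite !mxE enum_rankK.
Qed.

(** Throughout this section B is the subalgebra of Q generated by V.  Subspaces
    are described by lists: the n-th power of the space V is the span of
    [monomials V n], a finitely generated right ideal is [rideal U]. *)

Section Filtration.
Variables (F : fieldType) (Q : algType F) (V : seq Q).
Hypothesis V1 : 1 \in V.
Implicit Types (W : set Q) (U s t : seq Q) (x y z b : Q).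
Notation sp := (span_mod zero_sp).
Notation "V ^^ n" := (monomials V n) (at level 30).

Let sp_subsp s : is_subspace (sp s). Proof. exact/spn_subsp/subsp_zero. Qed.
Hint Resolve sp_subsp subsp_zero : core.

Lemma sp_mem s x : x \in s -> sp s x. Proof. exact: spn_mem. Qed.
Lemma spS s t x : {subset s <= t} -> sp s x -> sp t x. Proof. exact: spnS. Qed.

Definition subalg x := exists n, sp (V ^^ n) x.
Notation B := subalg.

Lemma sp_monomials_mono m n x : (m <= n)%N -> sp (V ^^ m) x -> sp (V ^^ n) x.
Proof. by move=> mn; apply: spS => y; exact: monomials_mono. Qed.

Lemma sp_monomialsD m n x y : sp (V ^^ m) x -> sp (V ^^ n) y ->
  sp (V ^^ (m + n)) (x * y).
Proof.
by apply: sp_products_ind => // a b am bn; apply: sp_mem; exact: monomialsD.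
Qed.

Lemma subalg_subsp : is_subspace B.
Proof.
split=> [|a x y [m xm] [n yn]]; first by exists 0%N; exact: subsp0.
exists (maxn m n); apply: subspD => //; [apply: subspZ => //|].
  by apply: sp_monomials_mono xm; rewrite leq_maxl.
by apply: sp_monomials_mono yn; rewrite leq_maxr.
Qed.
Hint Resolve subalg_subsp : core.

Lemma subalg_monomials n x : x \in V ^^ n -> B x.
Proof. by exists n; exact: sp_mem. Qed.

Lemma subalg1 : B 1. Proof. by apply: (@subalg_monomials 0); rewrite inE. Qed.

Lemma subalgM x y : B x -> B y -> B (x * y).
Proof. by move=> [m xm] [n yn]; exists (m + n)%N; exact: sp_monomialsD. Qed.
Hint Resolve subalg1 : core.

Lemma subalg_sp s x : (forall y, y \in s -> B y) -> sp s x -> B x.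
Proof. by move=> h; apply: spn_min => // _ ->; exact: subsp0. Qed.

Definition is_rideal W := is_subspace W /\ forall x b, W x -> B b -> W (x * b).

(** It is enough to test the generators in V. *)
Lemma is_rideal_gen W : is_subspace W -> (forall x v, W x -> v \in V ->
  W (x * v)) -> is_rideal W.
Proof.
move=> hW h; split=> // x b Wx [n bn].
apply: (spn_min (subsp_mull x hW) _ _ bn) => [_ ->|{bn b} b /= bn].
  by rewrite /= mulr0; exact: subsp0.
elim: n x b Wx bn => [|n IH] x b Wx; first by rewrite inE => /eqP ->; rewrite mulr1.
by case/allpairsP=> -[v w] /= [Vv wn ->]; rewrite mulrA; apply: IH => //; exact: h.
Qed.

Lemma is_rideal0 : is_rideal zero_sp.
Proof. by split=> // x b -> _; rewrite mul0r. Qed.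

Definition rideal U x := exists n, sp (products U (V ^^ n)) x.

Lemma products_mono U m n x : (m <= n)%N -> x \in products U (V ^^ m) ->
  x \in products U (V ^^ n).
Proof.
move=> mn; move: x; apply: products_ind => x y xU ym.
by apply: mem_products => //; exact: monomials_mono ym.
Qed.

Lemma rideal_mem U x : x \in U -> rideal U x.
Proof.
by move=> xU; exists 0%N; apply: sp_mem; rewrite -[x]mulr1 mem_products ?inE.
Qed.

Lemma rideal_is_rideal U : is_rideal (rideal U).
Proof.
apply: is_rideal_gen.
  split=> [|a x y [m xm] [n yn]]; first by exists 0%N; exact: subsp0.
  exists (maxn m n); apply: subspD => //; [apply: subspZ => //|].
    by apply: spS xm => z; apply: products_mono; rewrite leq_maxl.
  by apply: spS yn => z; apply: products_mono; rewrite leq_maxr.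
move=> x v [n xn] Vv; exists n.+1.
apply: (@sp_products_ind _ _ _ (products U (V ^^ n)) [:: v]) xn _ => //; last first.
  by apply: sp_mem; rewrite inE.
move=> {}x w + /[!inE] /eqP-> {w}; move: x; apply: products_ind => x y xU yn.
apply: sp_mem; rewrite -mulrA; apply: mem_products => //.
by rewrite -addn1; apply: monomialsD => //; rewrite monomials1.
Qed.
Hint Resolve rideal_is_rideal is_rideal0 : core.
Lemma rideal_subsp U : is_subspace (rideal U). Proof. by case: (rideal_is_rideal U). Qed.
Hint Resolve rideal_subsp : core.

Lemma rideal_mulr U x b : rideal U x -> B b -> rideal U (x * b).
Proof. by case: (rideal_is_rideal U) => _; exact. Qed.

Lemma rideal_min W U x : is_rideal W -> (forall u, u \in U -> W u) ->
  rideal U x -> W x.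
Proof.
move=> [hW hr] hU [n]; apply: spn_min => // [_ ->|]; first exact: subsp0.
apply: products_ind => u w uU wn; apply: hr; first exact: hU.
exact: subalg_monomials wn.
Qed.

Lemma rideal_products U n x : x \in products U (V ^^ n) -> rideal U x.
Proof. by exists n; exact: sp_mem. Qed.

Lemma rideal1 y x : rideal [:: y] x <-> exists b, B b /\ x = y * b.
Proof.
split=> [|[b [Bb ->]]]; last by apply: rideal_mulr => //; apply: rideal_mem;
  rewrite inE.
apply: (@rideal_min [set x | exists b, B b /\ x = y * b]) => [|u];
  last by rewrite inE => /eqP->; exists 1; rewrite mulr1.
split; last by move=> _ b [c [Bc ->]] Bb; exists (c * b); rewrite mulrA;
  split=> //; exact: subalgM.
split=> [|a _ _ [c [Bc ->]] [d [Bd ->]]].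
  by exists 0; rewrite mulr0; split=> //; exact: subsp0.
exists (a *: c + d); rewrite mulrDr scalerAr; split=> //.
by apply: subspD => //; exact: subspZ.
Qed.

Lemma rideal_subalg U x : (forall u, u \in U -> B u) -> rideal U x -> B x.
Proof. by move=> h; apply: (@rideal_min subalg) => //; split=> // *;
  exact: subalgM. Qed.

(** A row is the image of the right ideal U B in Q / W, filtered by the degree
    in V; it is finite-dimensional exactly when this filtration stops growing at
    some n. *)
Definition stable U W n := forall x, x \in products U (V ^^ n.+1) ->
  span_mod W (products U (V ^^ n)) x.

Lemma stable_rideal U W n x : is_rideal W -> stable U W n -> rideal U x ->
  span_mod W (products U (V ^^ n)) x.
Proof.
move=> [hW hr] hst; apply: (@rideal_min (span_mod W _)) => [|u uU]; last first.
  by apply: spn_mem => //; rewrite -[u]mulr1; apply: mem_products => //;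
    exact: monomials_one.
apply: is_rideal_gen; first exact: spn_subsp.
move=> z v hz Vv; apply: (spn_min (subsp_mulr v (spn_subsp _ hW)) _ _ hz) => /=.
  by move=> w Ww; apply: spn_base => /=; apply: hr => //;
    apply: (@subalg_monomials 1); rewrite monomials1.
apply: products_ind => u w uU wn; apply: hst; rewrite -mulrA.
by apply: mem_products => //; rewrite -addn1; apply: monomialsD => //;
  rewrite monomials1.
Qed.

(** A filtration that never stops gains a dimension at each step. *)
Lemma rows U W : is_subspace W -> (forall n, ~ stable U W n) -> forall n, exists t,
  [/\ size t = n, indep_mod W t & forall x, x \in t -> x \in products U (V ^^ n)].
Proof.
move=> hW h; elim=> [|n [t [st it tU]]]; first by exists [::].
have [x xU xn] : exists2 x, x \in products U (V ^^ n.+1) &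
  ~ span_mod W (products U (V ^^ n)) x.
  apply: contrapT => hx; apply: (h n) => x xU; apply: contrapT => nx.
  by apply: hx; exists x.
exists (x :: t); split; first by rewrite /= st.
  by split=> // hx; apply: xn; apply: spnS hx.
by move=> y /[!inE] /predU1P[->//|/tU]; exact: (products_mono (leqnSn n)).
Qed.

Hypothesis Binf : forall e, exists2 b, B b & ~ sp e b.

Lemma subalg_not_stable n : ~ stable [:: 1] zero_sp n.
Proof.
move=> h; have [b Bb] := Binf (products [:: 1] (V ^^ n)); apply.
by apply: stable_rideal => //; apply/rideal1; exists b; rewrite mul1r.
Qed.

(** A faithful linear family of maps from B to a space of dimension size e
    embeds B into (size e)^r, against the infinite dimension of B. *)
Lemma faithful_infinite r e (phi : 'I_r -> {linear Q -> Q}) :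
  (forall b j, B b -> sp e (phi j b)) ->
  ~ (forall b, B b -> (forall j, phi j b = 0) -> b = 0).
Proof.
move=> he hinj; have [t [st it tV]] :=
  rows subsp_zero subalg_not_stable (r * size e).+1.
have Bt b : b \in t -> B b.
  by move=> /tV/rideal_products/rideal1[c [Bc ->]]; rewrite mul1r.
have /choice[c hc] : forall k : 'I_(size t) * 'I_r, exists c : 'I_(size e) -> F,
    phi k.2 t`_k.1 = \sum_i c i *: e`_i.
  by move=> [m j]; apply: sp_coef; apply: he; apply: Bt; exact: mem_nth.
have [|v [[m vm] hv]] := @dependent_rows F ('I_r * 'I_(size e))%type (size t)
   (fun m k => c (m, k.1) k.2).
  by rewrite card_prod !card_ord st.
have b0 : \sum_m v m *: t`_m = 0.
  apply: hinj => [|j].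
    by apply: subsp_sum => // i _; apply: subspZ => //; apply: Bt; exact: mem_nth.
  rewrite linear_sum; under eq_bigr do rewrite linearZ /= (hc (_, j)) scaler_sumr.
  rewrite exchange_big big1 //= => i _; under eq_bigr do rewrite scalerA.
  by rewrite -scaler_suml (hv (j, i)) scale0r.
by move/eqP: vm; apply; exact: (indep_coef subsp_zero it b0).
Qed.

Hypothesis primeB : forall x y, B x -> B y -> x != 0 -> y != 0 ->
  exists n b, b \in V ^^ n /\ x * b * y != 0.

Lemma prime0 x y : B x -> B y -> (forall b, B b -> x * b * y = 0) -> x = 0 \/ y = 0.
Proof.
move=> Bx subalg_y h; case: (eqVneq x 0) => x0; [by left|right]; apply/eqP.
apply: contrapT => /negP y0; have [n [b [bn]]] := primeB Bx subalg_y x0 y0.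
by rewrite h ?eqxx //; exact: subalg_monomials bn.
Qed.

(** If y B were finite-dimensional, B would act on it from the right, and
    faithfully because B is prime. *)
Lemma not_stable1 y n : B y -> y != 0 -> ~ stable [:: y] zero_sp n.
Proof.
move=> subalg_y y0 hst; pose E := products [:: y] (V ^^ n).
have BE x : x \in E -> B x.
  by move=> /rideal_products; apply: rideal_subalg => u; rewrite inE => /eqP->.
have hE x : rideal [:: y] x -> sp E x by exact: stable_rideal.
apply: (@faithful_infinite (size E) E (fun j => E`_j \*o idfun)) =>
  [b j Bb|b Bb hb] /=.
  by apply: hE; apply: rideal_mulr => //; apply: rideal_products; exact: mem_nth.
have [|yz|//] := @prime0 y b subalg_y Bb; last by rewrite yz eqxx in y0.
move=> c Bc; have /sp_coef[d ->] : sp E (y * c) by apply: hE; apply/rideal1;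
  exists c.
rewrite mulr_suml big1 // => j _.
by have /= e := hb j; rewrite -scalerAl e scaler0.
Qed.

Lemma rideal_infinite y e : B y -> y != 0 -> ~ (forall b, B b -> sp e (y * b)).
Proof.
move=> subalg_y y0 h.
have [t [st it tU]] := rows subsp_zero (fun n =>
  @not_stable1 y n subalg_y y0) (size e).+1.
have := indep_size subsp_zero it (t := e); rewrite st ltnn => /(_ _)/negP;
  apply => //.
by move=> x /tU/rideal_products/rideal1[b [Bb ->]]; exact: h.
Qed.

(** * Depth and two-sided rows *)

(** Adding up the dimensions of the layers W (j+1) / W j. *)
Lemma stack_rows (W : nat -> set Q) (E : set Q) n k : (forall j,
  is_subspace (W j)) ->
  (forall j, (j < k)%N -> W j `<=` W j.+1) ->
  (forall j, (j < k)%N -> exists r,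
     [/\ size r = n, indep_mod (W j) r & forall x, x \in r -> W j.+1 x /\ E x]) ->
  exists t, [/\ size t = (k * n)%N, indep_mod (W 0%N) t & forall x, x \in t ->
    W k x /\ E x].
Proof.
move=> hW; elim: k => [|k IH] mono hr; first by exists [::].
have [t [st it ht]] := IH (fun j jk => mono j (ltnW jk)) (fun j jk =>
  hr j (ltnW jk)).
have [r [sr ir hr']] := hr k (leqnn _).
have sub : W 0%N `<=` W k.
  elim: k mono {IH hr t st it ht r sr ir hr'} => [_ x //|k IH mono] x.
  move=> /(IH (fun j jk => mono j (ltnW jk))); exact: mono.
exists (r ++ t); split; first by rewrite size_cat sr st mulSn.
  apply/indep_cat; split=> //; apply: indepW ir => //.
  by move=> x; apply: (spn_min (P := W k)) => // y /ht[].
move=> x; rewrite mem_cat => /orP[/hr'//|/ht[Wx Ex]]; split=> //.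
exact: mono.
Qed.

(** G k n is the set of the elements of depth at least k in degree n.  In the
    application these are the x such that z^i x lies in V^n for all i <= k, and
    Gdim compares independence over F with independence over K. *)
Variables (G : nat -> nat -> set Q) (C : nat).
Hypothesis G0 : forall n x, x \in V ^^ n -> G 0 n x.
Hypothesis GM : forall k l m n x y, G k m x -> G l n y -> G (k + l) (m + n) (x * y).
Hypothesis GW : forall k l m n x, (l <= k)%N -> (m <= n)%N -> G k m x -> G l n x.
Hypothesis GB : forall k n x, G k n x -> B x.
Hypothesis Gdim : forall k n s, (0 < n)%N -> (forall x, x \in s -> G k n x) ->
  (k.+1 * rank_mod zero_sp s <= C * n ^ 2)%N.
Hypothesis G1 : exists d x, x != 0 /\ G 1 d x.

Lemma G_products k l m n s t : (forall x, x \in s -> G k m x) ->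
  (forall x, x \in t -> G l n x) -> forall x, x \in products s t ->
    G (k + l) (m + n) x.
Proof. by move=> hs ht; apply: products_ind => x y /hs ? /ht ?; exact: GM. Qed.

Lemma G_productsV k m n s : (forall x, x \in s -> G k m x) ->
  forall x, x \in products s (V ^^ n) -> G k (m + n) x.
Proof. by move=> hs; rewrite -[k]addn0; apply: G_products => // x /G0. Qed.

Lemma G_monomials d k X : (forall x, x \in X -> G 1 d x) ->
  forall x, x \in X ^^ k -> G k (d * k) x.
Proof.
move=> hX; elim: k => [|k IH] x; first by rewrite muln0 => ?; apply: G0.
by rewrite mulnS; exact: (@G_products 1 k).
Qed.

(** Products of elements of depth 1, kept nonzero by primeness. *)
Lemma G_deep m : exists d x, x != 0 /\ G m d x.
Proof.
elim: m => [|m [d [x [x0 Gx]]]].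
  by exists 0%N, 1; rewrite oner_eq0; split=> //; apply: G0; rewrite inE.
have [e [y [y0 Gy]]] := G1.
have [n [b [bn xby]]] := primeB (GB Gx) (GB Gy) x0 y0.
exists (d + n + e)%N, (x * b * y); split=> //.
by rewrite -addn1 -{1}[m]addn0; apply: GM => //; apply: GM => //; exact: G0.
Qed.

Definition left_row x i := products (V ^^ i) [:: x].
(** Row i is taken modulo this right ideal, so that it only counts what the
    previous rows miss. *)
Definition rows_below x i := if i is i'.+1 then rideal (left_row x i') else zero_sp.

Lemma rows_below_subsp x i : is_subspace (rows_below x i). Proof. by case: i =>
  /=. Qed.
Lemma rows_below_is_rideal x i : is_rideal (rows_below x i). Proof. by case: i => /=. Qed.
Hint Resolve rows_below_subsp rows_below_is_rideal : core.

Lemma left_row_self x i : x \in left_row x i.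
Proof. by have := mem_products (monomials_one i V1) (mem_head x [::]);
  rewrite mul1r. Qed.

Lemma left_row_mono x i j y : (i <= j)%N -> y \in left_row x i -> y \in left_row x j.
Proof.
move=> ij; move: y; apply: products_ind => v w vi wx; apply: mem_products => //.
exact: monomials_mono vi.
Qed.

Lemma unstable_rows x : (forall i n, ~ stable (left_row x i) (rows_below x i) n) ->
  forall n, exists t, [/\ size t = (n * n)%N, indep_mod zero_sp t &
    forall y, y \in t -> y \in products (left_row x n) (V ^^ n)].
Proof.
move=> h n.
have [//|j _|j jn|t [st it ht]] := @stack_rows (rows_below x)
  [set y | y \in products (left_row x n) (V ^^ n)] n n.
- case: j => [|j] /= y; first by move->; exact: subsp0.
  apply: rideal_min => // z zj; apply: rideal_mem; apply: left_row_mono zj => //.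
- have [r [sr ir hr]] := rows (rows_below_subsp x j) (h j) n.
  exists r; split=> // y /hr yr; split; first exact: rideal_products yr.
  move: y yr; apply: products_ind => u v uj vn; apply: mem_products => //.
  by apply: left_row_mono uj; exact: ltnW.
by exists t; split=> // y /ht[].
Qed.

(** The first row is x B itself, which is infinite-dimensional; so a finite row
    has a predecessor. *)
Lemma stable_row x : B x -> x != 0 -> (exists i n,
  stable (left_row x i) (rows_below x i) n) ->
  exists i n, stable (left_row x i.+1) (rideal (left_row x i)) n.
Proof.
move=> Bx x0 [[|i] [n h]]; last by exists i, n.
by case: (@not_stable1 x n Bx x0); move: h; rewrite /left_row /products /= mul1r.
Qed.

(** If row i+1 is finite-dimensional, multiplying the right ideal generated by
    V^i x by an element of V only adds the finite-dimensional row i+1 to it, so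
    a product of l elements of V adds finitely many dimensions as well. *)
Lemma almost_left_closed x i n : stable (left_row x i.+1) (rideal (left_row x i)) n ->
  forall l, exists e, forall b y, b \in V ^^ l -> rideal (left_row x i) y ->
    span_mod (rideal (left_row x i)) e (b * y).
Proof.
move=> h; set X := left_row x i; set E := products (left_row x i.+1) (V ^^ n).
have hV v y : v \in V -> rideal X y -> span_mod (rideal X) E (v * y).
  move=> Vv hy; apply: stable_rideal => //.
  apply: (rideal_min (W := [set z | rideal (left_row x i.+1) (v * z)])) hy.
    split=> [|z b /= hz Bb]; first exact: subsp_mull.
    by rewrite mulrA; exact: rideal_mulr.
  apply: products_ind => w z wi zx /=; apply: rideal_mem; rewrite mulrA.
  by do 2?[apply: mem_products => //].
elim=> [|l [e IH]].
  by exists [::] => b y; rewrite inE => /eqP-> hy; rewrite mul1r.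
exists (E ++ products V e) => b y /allpairsP[[v w] /= [Vv wl ->]] hy.
rewrite -mulrA; move: (IH w y wl hy).
apply: (spn_min (P := [set z | span_mod (rideal X) (E ++ products V e) (v * z)])).
- by apply: subsp_mull; exact: spn_subsp.
- by move=> z hz /=; apply: spnS (hV v z Vv hz) => // u uE; rewrite mem_cat uE.
- by move=> z ze /=; apply: spn_mem => //; rewrite mem_cat; apply/orP; right;
  exact: mem_products.
Qed.

(** Let X = V^i x and let e be a nonzero element of X^k.  If e X = 0, then
    e kills X B, so by [almost_left_closed] every right ideal e b x B is
    finite-dimensional, hence 0; this contradicts primeness. *)
Lemma stable_row_not_nilpotent x i n : B x -> x != 0 ->
  stable (left_row x i.+1) (rideal (left_row x i)) n ->
  forall k, exists2 e, e \in left_row x i ^^ k & e != 0.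
Proof.
move=> Bx x0 h; elim=> [|k [e ek e0]].
  by exists 1; rewrite ?inE ?oner_eq0.
have BX y : y \in left_row x i -> B y.
  move: y; apply: products_ind => u v /subalg_monomials Bu /[!inE] /eqP->;
    exact: subalgM.
have Be : B e.
  elim: k e ek {e0} => [|k IH] e; first by rewrite inE => /eqP->.
  by case/allpairsP=> -[u v] /= [/BX Bu /IH Bv ->]; exact: subalgM.
have [l [b [bl ebx]]] := primeB Be Bx e0 x0.
have [y yX ey] : exists2 y, y \in left_row x i & e * y != 0.
  apply: contrapT => hn; have [E hE] := almost_left_closed h l.
  have Bb := subalg_monomials bl;
    apply: (@rideal_infinite (e * b * x) (products [:: e] E)) => //.
    by apply: subalgM => //; exact: subalgM.
  move=> c Bc; have xX : rideal (left_row x i) (x * c).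
    by apply: rideal_mulr => //; apply: rideal_mem; exact: left_row_self.
  have := hE b (x * c) bl xX; rewrite -!mulrA.
  apply: (spn_min (P := [set z | sp (products [:: e] E) (e * z)])).
  - exact: subsp_mull.
  - move=> z hz /=; suff -> : e * z = 0 by exact: subsp0.
    apply: (rideal_min (W := [set z | e * z = 0])) hz => [|u uX] /=.
      split=> [|u v /= eu _]; last by rewrite mulrA eu mul0r.
      split=> [|a u v /= eu ev]; first by rewrite /= mulr0.
      by rewrite mulrDr -scalerAr eu ev scaler0 addr0.
    by apply/eqP; apply: contrapT => /negP eu; apply: hn; exists u.
  - by move=> z zE /=; apply: sp_mem; apply: mem_products; rewrite ?inE.
exists (e * y) => //; rewrite -addn1; apply: monomialsD => //; by rewrite monomials1.
Qed.

(** A deep element x cannot have all its rows infinite, for then V^n x V^n would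
    have dimension n^2 with a constant that does not depend on x. *)
Lemma exists_not_nilpotent : exists d X, (forall x, x \in X -> G 1 d x) /\
  forall k, exists2 e, e \in X ^^ k & e != 0.
Proof.
have [d [x [x0 Gx]]] := G_deep (9 * C).+1; have Bx := GB Gx.
case: (EM (exists i n, stable (left_row x i) (rows_below x i) n)) => [h|h].
  have [i [n hi]] := stable_row Bx x0 h.
  exists (i + d)%N, (left_row x i); split; last exact: stable_row_not_nilpotent hi.
  apply: products_ind => u v ui /[!inE] /eqP ->; apply: GW (GM (G0 ui) Gx) => //.
have [|t [st it ht]] := @unstable_rows x _ d.+1.
  by move=> i n hi; apply: h; exists i, n.
(* with n = d + 1 the degree n + d + n is less than 3 n *)
have := @Gdim (9 * C).+1 (d.+1 + d + d.+1)%N t _ _.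
rewrite (indep_rkE it) st => /(_ isT); rewrite leqNgt => /(_ _)/negP[].
  move=> y /ht; move: y; apply: G_productsV; rewrite -[(9 * C).+1]add0n.
  apply: G_products => [y /G0//|y]; by rewrite inE => /eqP->.
by rewrite -mulnn; nia.
Qed.

(** * Right ideals of linear growth *)

Lemma rideal_monomialsS X a x : (forall x, x \in X -> B x) ->
  rideal (X ^^ a.+1) x -> rideal (X ^^ a) x.
Proof.
move=> BX; apply: rideal_min => // u; rewrite -addn1 => /monomials_split[v [w [va]]].
by rewrite monomials1 => /BX Bw ->; apply: rideal_mulr => //; exact: rideal_mem.
Qed.

(** Finitely many elements involve only finitely many degrees of the right
    ideal. *)
Lemma rideal_level U E (l : seq Q) : (forall x, x \in l ->
  span_mod (rideal U) E x) ->
  exists r, forall x, x \in l -> sp (E ++ products U (V ^^ r)) x.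
Proof.
elim: l => [|x l IH] h; first by exists 0%N.
have [|r hr] := IH; first by move=> y yl; apply: h; rewrite inE yl orbT.
have [c [n hn]] := spn_coef (h x (mem_head _ _)).
have mono m y : (m <= maxn r n)%N -> sp (E ++ products U (V ^^ m)) y ->
    sp (E ++ products U (V ^^ maxn r n)) y.
  move=> le; apply: spS => z; rewrite !mem_cat => /orP[->//|/(products_mono le)->].
  by rewrite orbT.
exists (maxn r n) => y /[!inE] /predU1P[->|/hr]; last by apply: mono;
  rewrite leq_maxl.
apply: (mono n); first by rewrite leq_maxr.
rewrite -(subrK (\sum_i c i *: E`_i) x); apply: subspD => //.
  by apply: spS hn => z zU; rewrite mem_cat zU orbT.
by apply: spn_sum => // i; rewrite mem_cat mem_nth.
Qed.

(** The hypothesis [step] says that X^a B / X^(a+1) B is finite-dimensional: it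
    is reached in degree s, with error terms of degree r. *)
Section Block.
Variables (X : seq Q) (d a s r : nat).
Hypothesis GX : forall x, x \in X -> G 1 d x.
Hypothesis step : forall x, x \in products (X ^^ a) (V ^^ s.+1) ->
  sp (products (X ^^ a) (V ^^ s) ++ products (X ^^ a.+1) (V ^^ r)) x.

Notation P j n := (products (X ^^ j) (V ^^ n)).

(** Multiplication by powers of X on the left. *)
Lemma step_shift i x : x \in P (i + a) s.+1 -> sp (P (i + a) s ++ P (i + a).+1 r) x.
Proof.
move: x; apply: products_ind => w v /monomials_split[p [q [pi qa ->]]] vs.
rewrite -mulrA; have := step (mem_products qa vs).
apply: (spn_min (P := [set z | sp (P (i + a) s ++ P (i + a).+1 r) (p * z)])).
- exact: subsp_mull.
- by move=> _ -> /=; rewrite mulr0; exact: subsp0.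
move=> z; rewrite mem_cat => /orP[] h; apply: sp_mem; rewrite mem_cat;
  apply/orP; [left|right];
  move: z h; apply: products_ind => y u yq us; rewrite mulrA;
    apply: mem_products => //.
  exact: monomialsD.
by rewrite -addnS; exact: monomialsD.
Qed.

Lemma step_any i n x : x \in P (i + a) n ->
  sp (P (i + a) s ++ P (i + a).+1 (r + n)) x.
Proof.
elim: n x => [|n IH] x.
  by move=> h; apply: sp_mem; rewrite mem_cat (products_mono _ h).
move: x; apply: products_ind => q w qa; rewrite -addn1 =>
  /monomials_split[u [v [un]]].
rewrite monomials1 => Vv ->; rewrite mulrA; move: (IH _ (mem_products qa un)).
apply: (spn_min (P := [set z | sp (P (i + a) s ++ P (i + a).+1 (r + (n + 1))) (z * v)])).
- exact: subsp_mulr.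
- by move=> _ -> /=; rewrite mul0r; exact: subsp0.
have V1v : v \in V ^^ 1 by rewrite monomials1.
move=> z; rewrite mem_cat => /orP[]; move: z; apply: products_ind =>
  y t yq ts /=; rewrite -mulrA.
  have : y * (t * v) \in P (i + a) s.+1.
    by apply: mem_products => //; rewrite -addn1; exact: monomialsD.
  move=> /step_shift; apply: spS => z; rewrite !mem_cat => /orP[->//|h].
  by apply/orP; right; apply: products_mono h; exact: leq_addr.
apply: sp_mem; rewrite mem_cat; apply/orP; right; apply: mem_products => //.
by rewrite addnA; exact: monomialsD.
Qed.

Definition block m n := flatten [seq P (i + a) s | i <- iota m n].

Lemma blockP m n x : x \in block m n -> exists i, [/\ (m <= i < m + n)%N &
  x \in P (i + a) s].
Proof. by case/flattenP=> _ /mapP[i + ->]; rewrite mem_iota => ? ?; exists i. Qed.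

Lemma block_cat m n : block 0 (m + n) = block 0 m ++ block m n.
Proof. by rewrite /block iotaD map_cat flatten_cat. Qed.

(** Each expansion trades the monomials in V of unbounded degree for one more
    factor X, at the cost of raising the degree by the constant r. *)
Lemma expand k n x : x \in P a n -> sp (block 0 k ++ P (k + a) (k * r + n)) x.
Proof.
elim: k => [|k IH] h; first by apply: sp_mem; rewrite mem_cat h orbT.
apply: spn_sub (IH h) => // [_ ->|y]; first exact: subsp0.
rewrite -[k.+1]addn1 block_cat mem_cat => /orP[yb|/step_any].
  by apply: sp_mem; rewrite !mem_cat yb.
apply: spS => z; rewrite !mem_cat => /orP[zs|]; last first.
  by rewrite addn1 mulSn addnA => ->; rewrite orbT.
by rewrite zs /= orbT.
Qed.

Lemma G_P j n x : x \in P j n -> G j (d * j + n) x.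
Proof. by move: x; apply: G_productsV => x; exact: G_monomials. Qed.

Lemma Gdim_lin m (e : nat) (l : seq Q) : (0 < m)%N -> (0 < e)%N -> (forall x,
  x \in l -> G m (e * m) x) ->
  (rank_mod zero_sp l <= C * e ^ 2 * m)%N.
Proof.
move=> m0 e0 h; have := Gdim (n := e * m) _ h; rewrite muln_gt0 e0 m0 => /(_ isT).
by rewrite expnMn => H; rewrite -(leq_pmul2l m0); nia.
Qed.

Let e1 := (d * a + 2 * d + s).+1.
Let e2 := (d * a + d + 1 + r)%N.

(** Doubling: the second half of the block of length 2^(p+1) has depth 2^p in a
    degree linear in 2^p, so its rank is linear in 2^p as well. *)
Lemma rk_block p :
  (rank_mod zero_sp (block 0 (2 ^ p)) <= C * e1 ^ 2 * 2 ^ p + rank_mod zero_sp (block 0 1))%N.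
Proof.
elim: p => [|p IH]; first by rewrite leq_addl.
have p0 : (0 < 2 ^ p)%N by rewrite expn_gt0.
rewrite expnS mul2n -addnn block_cat; apply: (leq_trans (rk_cat _ _ _)) => //.
have : (rank_mod zero_sp (block (2 ^ p) (2 ^ p)) <= C * e1 ^ 2 * 2 ^ p)%N.
  apply: Gdim_lin => // x /blockP[i [hi /G_P]]; apply: GW; rewrite /e1; nia.
by move: IH; lia.
Qed.

Lemma rk_expand p : (rank_mod zero_sp (P a (2 ^ p)) <=
  (C * e1 ^ 2 + C * e2 ^ 2) * 2 ^ p + rank_mod zero_sp (block 0 1))%N.
Proof.
have p0 : (0 < 2 ^ p)%N by rewrite expn_gt0.
apply: (leq_trans (rk_le subsp_zero (fun x => @expand (2 ^ p) (2 ^ p) x))).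
apply: (leq_trans (rk_cat _ _ _)) => //.
have : (rank_mod zero_sp (P (2 ^ p + a) (2 ^ p * r + 2 ^ p)) <= C * e2 ^ 2 * 2 ^ p)%N.
  apply: Gdim_lin => // [|x /G_P]; first by rewrite /e2; lia.
  by apply: GW; rewrite /e2; nia.
by have := rk_block p; lia.
Qed.
End Block.

(** Otherwise X^n V^n, ..., X^(2n-1) V^n would contribute n dimensions each to a
    space of depth n in degree O(n). *)
Lemma stable_power d (X : seq Q) : (forall x, x \in X -> G 1 d x) ->
  exists a n, stable (X ^^ a.+1) (rideal (X ^^ a.+2)) n.
Proof.
move=> GX; apply: contrapT => h; set n := (C * (2 * d + 1) ^ 2).+1.
have BX x : x \in X -> B x by move=> /GX/GB.
(* the rows X^(2n-1), ..., X^n, each modulo the right ideal of the next power *)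
pose W j := rideal (X ^^ (2 * n - j)).
have [j|j jn|j jn|t [st it ht]] := @stack_rows W (fun x =>
  G n (2 * d * n + n) x) n n.
- exact: rideal_subsp.
- rewrite /W; have -> : (2 * n - j = (2 * n - j.+1).+1)%N by lia.
  by move=> x; exact: rideal_monomialsS.
- have [m hm|r [sr ir hr]] := @rows (X ^^ (2 * n - j.+1)) (W j) (@rideal_subsp _) _ n.
    rewrite /W in hm; have e : (2 * n - j = (2 * n - j.+2).+2)%N by lia.
    apply: h; exists (2 * n - j.+2)%N, m; rewrite e in hm.
    have e' : (2 * n - j.+1 = (2 * n - j.+2).+1)%N by lia.
    by rewrite e' in hm.
  exists r; split=> // x /hr xr; split; first exact: rideal_products xr.
  by apply: GW (G_P GX xr); nia.
have it0 : indep_mod zero_sp t by apply: indepW it => [|_ ->];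
  [|apply: subsp0]; exact: rideal_subsp.
have := @Gdim n (2 * d * n + n)%N t; rewrite (indep_rkE it0) st addn_gt0 orbT.
move=> /(_ isT); rewrite leqNgt => /(_ _)/negP[]; first by move=> x /ht[].
have -> : (2 * d * n + n = (2 * d + 1) * n)%N by lia.
by rewrite expnMn -mulnn mulnA /n; set k := (C * _)%N; nia.
Qed.

(** Depth 1 up to linear combinations over F: G itself need not be a subspace. *)
Definition deep y := exists d s, (forall x, x \in s -> G 1 d x) /\ sp s y.

Lemma linear_growth : exists y c c0, [/\ y != 0, deep y &
  forall N, exists2 n, (N <= n)%N &
    (rank_mod zero_sp (products [:: y] (V ^^ n)) <= c * n + c0)%N].
Proof.
have [d [X [GX nX]]] := exists_not_nilpotent.
have [a [s hs]] := stable_power GX.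
have [r hr] := rideal_level (hs : forall x, x \in _ -> span_mod _ _ x).
have [y ya y0] := nX a.+1.
have := @rk_expand X d a.+1 s r GX hr; set c := addn _ _; set c0 :=
  rank_mod _ _ => h.
exists y, c, c0; split=> //.
  exists (d * a.+1)%N, [:: y]; split; last by apply: sp_mem; rewrite inE.
  by move=> x /[!inE] /eqP->; apply: GW (G_monomials GX ya).
move=> N; exists (2 ^ N)%N; first exact/ltnW/ltn_expl.
apply: leq_trans (h N); apply: rk_le => //.
apply: products_ind => x v /[!inE] /eqP-> vn; apply: sp_mem; exact: mem_products.
Qed.

(** * Critical right ideals *)

Lemma deepM y b : deep y -> B b -> deep (y * b).
Proof.
move=> [d [s [hs ys]]] [n bn]; exists (d + n)%N, (products s (V ^^ n)); split.
  exact: G_productsV.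
exact: sp_products.
Qed.

Lemma deep_subalg y : deep y -> B y.
Proof. by move=> [d [s [hs]]]; apply: subalg_sp => x /hs/GB. Qed.

(** Only infinitely many n are required, which is what dyadic blocks give and
    what a strict descent on c needs.  The constant c0 absorbs shifts of degree. *)
Definition linearly_growing c y := exists c0, forall N, exists2 n, (N <= n)%N &
  (rank_mod zero_sp (products [:: y] (V ^^ n)) <= c * n + c0)%N.

Lemma sp_row y m n b : sp (V ^^ m) b -> {in products [:: y * b] (V ^^ n), forall x,
  sp (products [:: y] (V ^^ (m + n))) x}.
Proof.
move=> bm; apply: products_ind => x w /[!inE] /eqP-> wn; rewrite -mulrA.
apply: sp_products; first by apply: sp_mem; rewrite inE.
by apply: sp_monomialsD => //; exact: sp_mem.
Qed.

(** Take c least.  If y B / m B is infinite-dimensional for m = y b, then it takes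
    at least n of the c n + c0 dimensions of y V^n, so that m grows at most like
    (c - 1) n. *)
Lemma critical : exists y c, [/\ y != 0, deep y, linearly_growing c y &
  forall m, rideal [:: y] m -> m != 0 -> exists E, forall x, rideal [:: y] x ->
    span_mod (rideal [:: m]) E x].
Proof.
pose P c := `[< exists y, [/\ y != 0, deep y & linearly_growing c y] >].
have exP : exists c, P c.
  have [y [c [c0 [y0 dy h]]]] := linear_growth; exists c; apply/asboolP.
  by exists y; split=> //; exists c0.
case: (ex_minnP exP) => c /asboolP[y [y0 dy [c0 gy]]] minc.
exists y, c; split=> //; first by exists c0.
move=> m /rideal1[b [Bb em]] m0; case: (EM (exists n,
  stable [:: y] (rideal [:: m]) n)).
  by move=> [n hn]; exists (products [:: y] (V ^^ n)) => x; exact: stable_rideal.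
move=> /forallNP hn; exfalso; have [e be] := Bb.
have key n : (e <= n)%N -> (rank_mod zero_sp (products [:: m] (V ^^ (n - e))) + n <=
    rank_mod zero_sp (products [:: y] (V ^^ n)))%N.
  move=> en; have [t [st it ht]] := rows (@rideal_subsp _) hn n.
  have [t' [t's it' <- _]] := rk_basis (products [:: m] (V ^^ (n - e))) subsp_zero.
  rewrite -{1}st addnC -size_cat; apply: indep_rk => //.
    apply/indep_cat; split=> //; apply: indepW it; first exact: rideal_subsp.
    move=> x; apply: (spn_min (P := rideal [:: m])) => [|_ ->|z /t's] //.
      exact: subsp0.
    exact: rideal_products.
  move=> x; rewrite mem_cat => /orP[/ht/sp_mem//|/t's].
  by rewrite em => /(sp_row be); rewrite subnKC.
case: c minc gy => [|c] minc gy.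
  (* c = 0 would bound the dimension of y V^n *)
  have [n nN] := gy (e + c0).+1; have := key n; lia.
suff /minc : P c by rewrite ltnn.
apply/asboolP; exists m; split=> //; first by rewrite em; exact: deepM.
exists (c * e + c0)%N => N; have [n nN hn'] := gy (N + e)%N.
exists (n - e)%N; first by lia.
have := key n; rewrite mulnBr; have : (c * e <= c * n)%N by rewrite leq_mul2l; lia.
by move: hn'; rewrite mulSn; lia.
Qed.

Lemma subalg_sum (I : Type) (r : seq I) (p : pred I) (E : I -> Q) :
  (forall i, B (E i)) -> B (\sum_(i <- r | p i) E i).
Proof. by move=> h; apply: subsp_sum. Qed.

Lemma subalg_prod (I : Type) (r : seq I) (E : I -> Q) :
  (forall i, B (E i)) -> B (\prod_(i <- r) E i).
Proof. by move=> h; apply: big_ind => //; exact: subalgM. Qed.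

Lemma subalg_stdpoly N (b : 'I_N -> Q) : (forall i, B (b i)) -> B (stdpoly b).
Proof.
move=> h; apply: subalg_sum => s; rewrite sign_scale.
by apply: subspZ => //; exact: subalg_prod.
Qed.

Lemma subalg_horner u p : B u -> B (horner_alg u p).
Proof.
move=> Bu; elim/poly_ind: p => [|p a IH]; first by rewrite rmorph0; exact: subsp0.
rewrite rmorphD rmorphM /= horner_algX horner_algC.
by apply: subspD => //; [exact: subalgM|exact: subspZ].
Qed.

Section Critical.
Variables (y : Q) (c : nat).
Hypotheses (y0 : y != 0) (dy : deep y) (gy : linearly_growing c y).
Hypothesis crit : forall m, rideal [:: y] m -> m != 0 -> exists E, forall x,
  rideal [:: y] x -> span_mod (rideal [:: m]) E x.
Notation M := (rideal [:: y]).

Lemma subalg_y : B y. Proof. exact: deep_subalg. Qed.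
Hint Resolve subalg_y : core.

Lemma subalg_M x : M x -> B x.
Proof. by apply: rideal_subalg => u /[!inE] /eqP->. Qed.

Lemma M_y : M y. Proof. by apply: rideal_mem; rewrite inE. Qed.
Hint Resolve M_y : core.

(** The kernel m B has finite codimension in y B, so a y B would be a
    finite-dimensional right ideal. *)
Lemma M_inj a m : B a -> a * y != 0 -> M m -> m != 0 -> a * m != 0.
Proof.
move=> Ba ay Mm m0; apply/eqP => am; have [E hE] := crit Mm m0.
apply: (@rideal_infinite (a * y) (products [:: a] E)) => // [|b Bb];
  first exact: subalgM.
have : M (y * b) by exact: rideal_mulr.
rewrite -mulrA => /hE; apply: (spn_min (P :=
  [set z | sp (products [:: a] E) (a * z)])).
- exact: subsp_mull.
- by move=> _ /rideal1[d [_ ->]] /=; rewrite mulrA am mul0r; exact: subsp0.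
- by move=> z zE /=; apply: sp_mem; apply: mem_products; rewrite ?inE.
Qed.

(** * A transcendental left multiplication *)

Section Transcendental.
Variable u : Q.
Hypothesis Mu : M u.
Hypothesis trans : forall p : {poly F}, p != 0 -> horner_alg u p * y != 0.
Notation ev := (horner_alg u).

Lemma torsion_free p m : p != 0 -> M m -> ev p * m = 0 -> m = 0.
Proof.
move=> p0 Mm h; apply/eqP; apply: contrapT => /negP m0.
have := M_inj (subalg_horner p (subalg_M Mu)) (trans p0) Mm m0; by rewrite h eqxx.
Qed.

(** Membership in the F(u)-space spanned by ms: dependence over F[u] with a
    nonzero denominator p. *)
Definition poly_span (ms : seq Q) x :=
  exists (p : {poly F}) (P : 'I_(size ms) -> {poly F}),
  p != 0 /\ ev p * x = \sum_j ev (P j) * ms`_j.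

Fixpoint poly_indep (ms : seq Q) : Prop :=
  if ms is x :: ms' then ~ poly_span ms' x /\ poly_indep ms' else True.

Definition powers J (ms : seq Q) := [seq u ^+ j * m | m <- ms, j <- iota 0 J].

Lemma powers_comb J ms x : sp (powers J ms) x ->
  exists P : 'I_(size ms) -> {poly F}, x = \sum_j ev (P j) * ms`_j.
Proof.
apply: (spn_min (P := [set x | exists P : 'I_(size ms) -> {poly F},
   x = \sum_j ev (P j) * ms`_j])).
- split=> [|a _ _ [p ->] [q ->]].
    by exists (fun=> 0); rewrite big1 // => j _; rewrite rmorph0 mul0r.
  exists (fun j => a *: p j + q j); rewrite scaler_sumr -big_split.
  by apply: eq_bigr => j _ /=; rewrite linearP /= mulr_algl mulrDl scalerAl.
- by move=> _ -> /=; exists (fun=> 0); rewrite big1 // => j _; rewrite rmorph0 mul0r.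
move=> _ /allpairsP[[m j] /= [mms _ ->]].
have im : (index m ms < size ms)%N by rewrite index_mem.
exists (fun i => if i == Ordinal im then 'X^j else 0).
rewrite (bigD1 (Ordinal im)) //= eqxx nth_index // rmorphXn /= horner_algX.
by rewrite big1 ?addr0 // => i /negPf ->; rewrite rmorph0 mul0r.
Qed.

Lemma powers_indep J ms : poly_indep ms -> indep_mod zero_sp (powers J ms).
Proof.
elim: ms => //= m ms IH [hm /IH hms]; rewrite /powers /= -/(powers J ms).
apply/indep_cat; split=> //; apply: coef_indep => // a.
rewrite size_map size_iota => ha.
have e : \sum_(i < J) a i *: [seq u ^+ j * m | j <- iota 0 J]`_i =
    ev (\poly_(i < J) a i) * m.
  rewrite poly_def rmorph_sum mulr_suml; apply: eq_bigr => i _ /=.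
  rewrite (nth_map 0%N) ?size_iota // nth_iota // linearZ /= mulr_algl.
  by rewrite rmorphXn /= horner_algX scalerAl.
rewrite e in ha; have [P hP] := powers_comb ha => i iJ.
case: (eqVneq (\poly_(i < J) a i) 0) => [/polyP/(_ i)|p0].
  by rewrite coef_poly iJ coef0.
by case: hm; exists (\poly_(i < J) a i), P.
Qed.

(** u lies in y B, so multiplication by u raises the degree in y V^n by a fixed
    amount. *)
Lemma powers_level : exists h : nat, forall ms : seq Q, (forall m, m \in ms ->
  M m) ->
  exists e : nat, forall J x, x \in powers J ms ->
    sp (products [:: y] (V ^^ (h * J + e))) x.
Proof.
have [b [[g bg] eu]] := (rideal1 _ _).1 Mu; have [gy' yg] := subalg_y.
exists (g + gy')%N => ms hms.
have mono m n x : (m <= n)%N -> sp (products [:: y] (V ^^ m)) x ->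
  sp (products [:: y] (V ^^ n)) x.
  by move=> mn; apply: spS => z; exact: products_mono.
have [e he] : exists e : nat, forall m, m \in ms -> sp (products [:: y] (V ^^ e)) m.
  elim: ms hms => [|m ms IH] hms; first by exists 0%N.
  have [|e he] := IH; first by move=> z zs; apply: hms; rewrite inE zs orbT.
  have [f hf] := hms m (mem_head _ _); exists (maxn e f) =>
    z /[!inE] /predU1P[->|/he].
    by apply: mono hf; rewrite leq_maxr.
  by apply: mono; rewrite leq_maxl.
exists e => J x /allpairsP[[m j] /= [/he me + ->]].
rewrite mem_iota add0n => jJ.
suff : sp (products [:: y] (V ^^ ((g + gy') * j + e))) (u ^+ j * m).
  by apply: mono; rewrite leq_add2r leq_mul2l ltnW ?orbT.
elim: j {jJ} => [|j IH]; first by rewrite muln0 expr0 mul1r.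
rewrite exprS -mulrA mulnS -!addnA {1}eu -mulrA; apply: sp_products.
  by apply: sp_mem; rewrite inE.
apply: sp_monomialsD => //; move: IH; apply: sp_sub => //.
apply: products_ind => z w /[!inE] /eqP -> wn; apply: sp_monomialsD => //;
  exact: sp_mem.
Qed.

(** q independent elements over F[u] give q n / h independent elements of y V^n
    up to a bounded error, so q <= c h by linear growth. *)
Lemma poly_indep_bounded : exists K, forall ms : seq Q, poly_indep ms ->
  (forall m, m \in ms -> M m) -> (size ms <= K)%N.
Proof.
have [c0 hc] := gy; have [h lev] := powers_level; exists (c * h.+1)%N => ms ti hms.
have [e he] := lev ms hms; rewrite leqNgt; apply/negP => big.
have key J n : (h * J + e <= n)%N ->
    (size ms * J <= rank_mod zero_sp (products [:: y] (V ^^ n)))%N.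
  move=> le; rewrite -[J in leqLHS](size_iota 0) -(size_allpairs (fun m j =>
    u ^+ j * m)).
  apply: indep_rk => //; first exact: powers_indep.
  by move=> x /he; apply: spS => z; exact: products_mono.
(* h.+1 instead of h, so as to divide by a positive number *)
pose N := ((c * h.+1 + c * e + c0).+1 * h.+1 + e)%N.
have [n Nn rn] := hc N; pose J := ((n - e) %/ h.+1)%N.
have J1 : (J * h.+1 <= n - e)%N by exact: leq_trunc_div.
have J2 : (n - e < J.+1 * h.+1)%N by rewrite -ltn_divLR.
have J3 : (c * h.+1 + c * e + c0 < J)%N by rewrite leq_divRL //;
  rewrite /N in Nn; lia.
have := leq_trans (key J n _) rn; rewrite /N in Nn.
move=> /(_ _)H; have {}H : (size ms * J <= c * n + c0)%N by apply: H; nia.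
have : ((c * h.+1).+1 * J <= c * n + c0)%N by apply: leq_trans H;
  rewrite leq_mul2r big orbT.
have : (c * n <= c * (J.+1 * h.+1 + e))%N by rewrite leq_mul2l; lia.
nia.
Qed.

Lemma poly_span_all : exists ms : seq Q, (forall m, m \in ms ->
  M m) /\ forall x, M x -> poly_span ms x.
Proof.
apply: contrapT => h.
suff grow k : exists ms : seq Q, [/\ size ms = k, poly_indep ms & forall m,
  m \in ms -> M m].
  have [K hK] := poly_indep_bounded; have [ms [sK ti hms]] := grow K.+1.
  by have := hK ms ti hms; rewrite sK ltnn.
elim: k => [|k [ms [sk ti hms]]]; first by exists [::].
have [x Mx nx] : exists2 x, M x & ~ poly_span ms x.
  apply: contrapT => hx; apply: h; exists ms; split=> // x Mx.
  by apply: contrapT => nx; apply: hx; exists x.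
exists (x :: ms); split=> //=; first by rewrite sk.
by move=> m /[!inE] /predU1P[->//|/hms].
Qed.

(** B acts on the finite-dimensional F(u)-space spanned by y B through matrices,
    and faithfully because B is prime. *)
Lemma transcendental_PI : exists N, forall b : 'I_N -> Q, (forall i, B (b i)) ->
  stdpoly b = 0.
Proof.
have [[|m ms] [hms tall]] := poly_span_all.
  have [p [P [p0]]] := tall y M_y; rewrite big_ord0 => /eqP e.
  by have := trans p0; rewrite e.
set n := size ms in tall; pose mm (i : 'I_n.+1) := (m :: ms)`_i.
have Mm i : M (mm i) by apply: hms; exact: mem_nth.
exists (n.+1 * n.+1).+1 => b Bb.
have [|p [p0 hp]] := @stdpoly_rep F Q B (horner_alg u) n mm _ _ b (leqnn _) Bb.
  move=> d Bd.
  have /choice[p /choice[P /all_and2[p0 hP]]] i := tall _ (rideal_mulr (Mm i) Bd).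
  exists (\prod_i p i), (\matrix_(i, j) ((\prod_(k | k != i) p k) * P i j)); split.
    exact/prodf_neq0.
  move=> i; rewrite (bigD1 i) //= mulrC rmorphM -!mulrA hP mulr_sumr.
  by apply: eq_bigr => j _; rewrite mxE rmorphM mulrA.
set s := stdpoly b in hp *; have Bs : B s by exact: subalg_stdpoly.
have ms0 i : mm i * s = 0.
  by apply: (torsion_free p0); [exact: rideal_mulr|rewrite mulrA].
have xs0 x : M x -> x * s = 0.
  move=> Mx; have [q [P [q0 hq]]] := tall x Mx.
  apply: (torsion_free q0); first exact: rideal_mulr.
  rewrite mulrA hq mulr_suml big1 // => j _; rewrite -mulrA.
  by rewrite -[(m :: ms)`_j]/(mm j) ms0 mulr0.
have [d Bd||//] := @prime0 y s subalg_y Bs; last by move=> e; have := y0;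
  rewrite e eqxx.
by apply: xs0; exact: rideal_mulr.
Qed.
End Transcendental.

(** * Algebraic left multiplications *)

Section Algebraic.
Hypothesis algM : forall u, M u -> u * y != 0 ->
  exists p : {poly F}, p != 0 /\ horner_alg u p * y = 0.

Lemma M_left u m : M u -> M m -> M (u * m).
Proof. by move=> Mu /subalg_M; exact: rideal_mulr. Qed.

Lemma M_horner u p m : M u -> M m -> M (horner_alg u p * m).
Proof.
move=> Mu; elim/poly_ind: p m => [|p a IH] m Mm.
  by rewrite rmorph0 mul0r; exact: subsp0.
rewrite rmorphD rmorphM /= horner_algX horner_algC mulrDl mulr_algl -mulrA.
by apply: subspD => //; [apply: IH; exact: M_left|exact: subspZ].
Qed.

(** Left multiplication by u is injective, so the factors X can be removed from
    a polynomial killing y, until its constant term is nonzero. *)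
Lemma algebraic_const u : M u -> u * y != 0 -> exists (q : {poly F}) (a : F),
  a != 0 /\ u * (horner_alg u q * y) = a *: y.
Proof.
move=> Mu uy; have [p [p0]] := algM Mu uy; elim/poly_ind: p p0 => [|q a IH];
  first by rewrite eqxx.
rewrite rmorphD rmorphM /= horner_algX horner_algC mulrDl mulr_algl => p0 h.
have comm : horner_alg u q * u = u * horner_alg u q.
  transitivity (horner_alg u (q * 'X)); first by rewrite rmorphM /= horner_algX.
  by rewrite mulrC rmorphM /= horner_algX.
have [a0|a0] := eqVneq a 0; last first.
  exists (- q), a; split=> //; rewrite rmorphN mulNr mulrN mulrA -comm.
  by apply/eqP; rewrite eq_sym -addr_eq0 addrC h.
have q0 : q != 0 by apply: contra_neq p0 => ->; rewrite a0 mul0r addr0.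
apply: IH => //; apply/eqP; apply: contrapT => /negP nz.
have := M_inj (subalg_M Mu) uy (M_horner q Mu M_y) nz.
by rewrite mulrA -comm; move: h; rewrite a0 scale0r addr0 => ->; rewrite eqxx.
Qed.

(** For u = m b with u y <> 0, the relation of [algebraic_const] exhibits y in
    u B, hence in m B. *)
Lemma M_minimal m : M m -> m != 0 -> rideal [:: m] y.
Proof.
move=> Mm m0; have [n [b [/subalg_monomials Bb mby]]] :=
  primeB (subalg_M Mm) subalg_y m0 y0.
have Mu : M (m * b) by exact: rideal_mulr.
have [q [a [a0 h]]] := algebraic_const Mu mby.
rewrite -[y](scalerK a0) -h -mulrA; apply: subspZ => //; apply: rideal_mulr.
  by apply: rideal_mem; rewrite inE.
by apply: subalgM => //; apply: subalgM => //; exact/subalg_horner/subalg_M.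
Qed.

(** Choose u = y b with u y <> 0 and write y = u y w; then u f = u for
    f = y w b, and u is injective on y B. *)
Lemma idempotent_exists : exists f, M f /\ forall m, M m -> f * m = m.
Proof.
have [n [b [/subalg_monomials Bb yby]]] := primeB subalg_y subalg_y y0 y0.
have Mu : M (y * b) by exact: rideal_mulr.
have /rideal1[w [Bw e]] := M_minimal (M_left Mu M_y) yby.
have Mf : M (y * w * b) by do 2?apply: rideal_mulr.
exists (y * w * b); split=> // m Mm; apply/eqP; rewrite -subr_eq0.
apply: contrapT => /negP nz.
have := M_inj (subalg_M Mu) yby (subspB (@rideal_subsp _) (M_left Mf Mm) Mm) nz.
have -> : y * b * (y * w * b * m - m) = y * b * y * w * b * m - y * b * m.
  by rewrite mulrBr !mulrA.
by rewrite -e subrr eqxx.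
Qed.

Variable f : Q.
Hypotheses (Mf : M f) (fM : forall m, M m -> f * m = m).

Lemma f_idem : f * f = f. Proof. exact: fM. Qed.
Lemma f_neq0 : f != 0.
Proof. by apply: contra_neq y0 => f0; rewrite -(fM M_y) f0 mul0r. Qed.
Lemma subalg_f : B f. Proof. exact: subalg_M. Qed.
Hint Resolve subalg_f : core.

Lemma f_growing : linearly_growing c f.
Proof.
have [b [[l bl] ef]] := (rideal1 _ _).1 Mf; have [c0 h] := gy.
exists (c * l + c0)%N => N; have [n nN hn] := h (N + l)%N.
exists (n - l)%N; first by lia.
have : (rank_mod zero_sp (products [:: f] (V ^^ (n - l))) <= rank_mod zero_sp (products [:: y] (V ^^ n)))%N.
  apply: rk_le => // x; rewrite ef => /(sp_row bl); rewrite subnKC //; lia.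
rewrite mulnBr; have : (c * l <= c * n)%N by rewrite leq_mul2l; lia.
by lia.
Qed.

(** The corner ring f B f, with unit f. *)
Definition corner x := [/\ B x, f * x = x & x * f = x].

Lemma corner_M x : corner x -> M x.
Proof. by case=> Bx <- _; exact: rideal_mulr. Qed.

Lemma corner_f : corner f. Proof. by split=> //; exact: f_idem. Qed.

Lemma corner_mul x z : corner x -> corner z -> corner (x * z).
Proof.
move=> [Bx fx xf] [Bz fz zf]; split; first exact: subalgM.
  by rewrite mulrA fx.
by rewrite -mulrA zf.
Qed.

Lemma corner_subsp : is_subspace corner.
Proof.
split; first by split; rewrite ?mulr0 ?mul0r //; exact: subsp0.
move=> a x z [Bx fx xf] [Bz fz zf]; split.
- by apply: subspD => //; exact: subspZ.
- by rewrite mulrDr -scalerAr fx fz.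
- by rewrite mulrDl -scalerAl xf zf.
Qed.
Hint Resolve corner_subsp corner_f : core.

(** The endomorphism ring of the minimal right ideal f B (Schur). *)
Lemma corner_inv x : corner x -> x != 0 -> exists z, [/\ corner z, x * z = f &
  z * x = f].
Proof.
have right_inv z : corner z -> z != 0 -> exists2 w, corner w & z * w = f.
  move=> Dz z0; have [Bz fz zf] := Dz.
  have /rideal1[b [Bb ef]] := Mf; have /rideal1[w [Bw ey]] :=
    M_minimal (corner_M Dz) z0.
  have e : z * (w * b) = f by rewrite mulrA -ey.
  exists (f * (w * b) * f); last by rewrite !mulrA zf -[z * w * b]mulrA e f_idem.
  split; first by do 3?apply: subalgM.
    by rewrite !mulrA f_idem.
  by rewrite -mulrA f_idem.
move=> Dx x0; have [z Dz xz] := right_inv x Dx x0.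
have z0 : z != 0 by apply: contra_neq f_neq0 => z0; rewrite -xz z0 mulr0.
have [w Dw zw] := right_inv z Dz z0; exists z; split=> //.
have [_ fx xf] := Dx; have [_ fw _] := Dw.
by have -> : x = w by rewrite -xf -zw mulrA xz.
Qed.

(** * Subfields of the corner *)

Lemma indep_map W l (g : {linear Q -> Q}) : indep_mod zero_sp l ->
  (forall z, sp l z -> W (g z) -> z = 0) -> indep_mod W (map g l).
Proof.
elim: l => //= x l IH [nx il] h; split; last first.
  by apply: IH => // z lz; apply: h; exists 0; rewrite scale0r subr0.
move=> gx; apply: nx; suff [z lz Wz] : exists2 z, sp l z & W (g x - g z).
  have /eqP : x - z = 0.
    apply: h; last by rewrite linearB.
    by exists 1; rewrite scale1r addrAC subrr add0r; apply: subspN.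
  by rewrite subr_eq0 => /eqP->.
elim: l {IH il h} (g x) gx => [|w l IH] v /=; first by exists 0;
  [exact: subsp0|rewrite linear0 subr0].
move=> [a /IH[z lz Wz]]; exists (a *: w + z).
  by exists a; rewrite addrC addKr.
by rewrite linearP opprD addrA.
Qed.

(** A finite-dimensional commutative subalgebra of f B f, given by a basis; it is
    a field because f B f is a division ring. *)
Record subfield l : Prop := Subfield {
  subfieldD : forall x, x \in l -> corner x;
  subfieldC : forall x z, x \in l -> z \in l -> x * z = z * x;
  subfieldM : forall x z, x \in l -> z \in l -> sp l (x * z);
  subfield1 : sp l f;
  subfield_indep : indep_mod zero_sp l }.

Section Subfield.
Variable l : seq Q.
Hypothesis hl : subfield l.

Lemma sp_D x : sp l x -> corner x.
Proof.
apply: spn_min => // [_ ->|]; first exact: subsp0.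
exact: subfieldD.
Qed.

Lemma sp_mul x z : sp l x -> sp l z -> sp l (x * z).
Proof. by apply: sp_products_ind => //; exact: subfieldM. Qed.

Lemma sp_comm_with d : (forall x, x \in l -> d * x = x * d) ->
  forall x, sp l x -> d * x = x * d.
Proof.
move=> h; move=> x; apply: (spn_min (P := [set x | d * x = x * d])) => //.
  split=> [|a u v /= hu hv]; first by rewrite /= mulr0 mul0r.
  by rewrite mulrDr mulrDl -scalerAl -scalerAr hu hv.
by move=> _ -> /=; rewrite mulr0 mul0r.
Qed.

Lemma sp_comm x z : sp l x -> sp l z -> x * z = z * x.
Proof.
move=> lx lz; apply: sp_comm_with => // u ul; apply/esym.
by apply: sp_comm_with => // v vl; exact: (subfieldC hl).
Qed.

(** Multiplication by x maps the basis l to another basis, whose span contains f. *)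
Lemma sp_inv x : sp l x -> x != 0 -> exists z, sp l z /\ x * z = f.
Proof.
move=> lx x0; have [z [Dz xz zx]] := corner_inv (sp_D lx) x0.
have il : indep_mod zero_sp (map (x \*o idfun) l).
  apply: indep_map; first exact: subfield_indep.
  move=> w /sp_D[_ fw _] /= xw; by rewrite -fw -zx -mulrA xw mulr0.
case: (EM (sp (map (x \*o idfun) l) f)) => [h|h]; last first.
  have /= : indep_mod zero_sp (f :: map (x \*o idfun) l) by split.
  move=> hi; have := indep_size subsp_zero (hi : indep_mod _ (_ :: _)) (t := l).
  rewrite /= size_map ltnn => /(_ _)/negP; case=> //.
  move=> u /[!inE] /predU1P[->|/mapP[v vl ->]]; first exact: subfield1.
  by apply: sp_mul => //; exact: sp_mem.
suff [w lw ->] : exists2 w, sp l w & f = x * w by exists w.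
apply: (spn_min (P := [set u | exists2 w, sp l w & u = x * w])) h.
- split=> [|a _ _ [u lu ->] [v lv ->]]; first by exists 0; rewrite ?mulr0 //;
  exact: subsp0.
  by exists (a *: u + v); [apply: subspD => //;
    exact: subspZ|rewrite mulrDr scalerAr].
- by move=> _ ->; exists 0; rewrite ?mulr0 //; exact: subsp0.
- by move=> _ /mapP[v vl ->]; exists v => //; exact: sp_mem.
Qed.

Lemma sp_mul_row x n z : sp l x -> sp (products l (V ^^ n)) z ->
  sp (products l (V ^^ n)) (x * z).
Proof.
move=> lx; apply: (spn_min (P := [set z | sp (products l (V ^^ n)) (x * z)])).
- exact: subsp_mull.
- by move=> _ -> /=; rewrite mulr0; exact: subsp0.
apply: products_ind => u w ul wn /=; rewrite mulrA; apply: sp_products;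
  last exact: sp_mem.
by apply: sp_mul => //; exact: sp_mem.
Qed.

Lemma subfield_not_stable n : ~ stable l zero_sp n.
Proof.
move=> h; apply: (@rideal_infinite f (products l (V ^^ n)) subalg_f f_neq0) => b Bb.
apply: stable_rideal => //; apply: rideal_mulr => //.
by apply: (spn_min (P := rideal l)) (subfield1 hl) => // [_ ->|];
  [exact: subsp0|exact: rideal_mem].
Qed.

(** Let L be the field spanned by l.  The space L f V^n gains at least one
    dimension over L, that is size l dimensions over F, at each step; but it lies
    in f V^(e + n), whose dimension is about c n. *)
Lemma subfield_bounded : (size l <= c)%N.
Proof.
have [e he] : exists e, forall x, x \in l -> sp (V ^^ e) x.
  have : forall x, x \in l -> B x by move=> x /(subfieldD hl)[].
  elim: (l) => [|x l' IH] h; first by exists 0%N.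
  have [|e he] := IH; first by move=> z zl; apply: h; rewrite inE zl orbT.
  have [m xm] := h x (mem_head _ _); exists (maxn e m) => z /[!inE] /predU1P[->|/he].
    by apply: sp_monomials_mono xm; rewrite leq_maxr.
  by apply: sp_monomials_mono; rewrite leq_maxl.
have [c0 hc] := f_growing; rewrite leqNgt; apply/negP => big.
have key n : (n * size l <= rank_mod zero_sp (products [:: f] (V ^^ (e + n))))%N.
  have [j|j jn x|j jn|t [st it ht]] := @stack_rows (fun j =>
    sp (products l (V ^^ j)))
    setT (size l) n.
  - exact: sp_subsp.
  - by apply: spS => z; exact: products_mono.
  - have [x xl [w wj nfw]] : exists2 x, x \in l & exists2 w, w \in V ^^ j.+1 &
        ~ sp (products l (V ^^ j)) (f * w).
      apply: contrapT => h; apply: (@subfield_not_stable j);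
        apply: products_ind => x w xl wj.
      apply: contrapT => nxw; apply: h; exists x => //; exists w => // fw;
        apply: nxw.
      have [_ _ <-] := subfieldD hl xl; rewrite -mulrA.
      by apply: sp_mul_row => //; exact: sp_mem.
    exists (map (w \o* idfun) l); split; first by rewrite size_map.
      apply: indep_map; first exact: subfield_indep.
      move=> z lz /= zw; apply/eqP; apply: contrapT => /negP z0.
      have [u [lu zu]] := sp_inv lz z0; apply: nfw.
      by rewrite -zu (sp_comm lz lu) -mulrA; exact: sp_mul_row.
    move=> _ /mapP[u ul ->] /=; split=> //; apply: sp_mem; exact: mem_products.
  rewrite -st; apply: indep_rk => //.
    by apply: indepW it => // _ ->; exact: subsp0.
  move=> x /ht[+ _]; apply: sp_sub => //; apply: products_ind => u w ul wn.
  have [_ <- _] := subfieldD hl ul; rewrite -mulrA; apply: sp_products.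
    by apply: sp_mem; rewrite inE.
  by apply: sp_monomialsD; [exact: he|exact: sp_mem].
have [m mN hm] := hc (e + (c * e + c0).+1)%N.
have := key (m - e)%N; rewrite subnKC; last by lia.
move=> /leq_trans/(_ hm) H; pose k := (m - e)%N;
  have em : m = (e + k)%N by rewrite /k; lia.
have : ((c.+1) * k <= c * m + c0)%N by apply: leq_trans H;
  rewrite mulnC leq_mul2l big orbT.
rewrite {1}em; nia.
Qed.
End Subfield.

Lemma subfield_f : subfield [:: f].
Proof.
split=> [x|x z|x z||].
- by rewrite inE => /eqP->.
- by rewrite !inE => /eqP-> /eqP->.
- by rewrite !inE => /eqP-> /eqP->; rewrite f_idem; apply: sp_mem; rewrite inE.
- by apply: sp_mem; rewrite inE.
- by split=> // /= /eqP; rewrite (negPf f_neq0).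
Qed.

Lemma maximal_subfield : exists l, subfield l /\ forall l', subfield l' ->
  (size l' <= size l)%N.
Proof.
pose P k := `[< exists2 l, subfield l & size l = k >].
have exP : exists k, P k by exists 1%N; apply/asboolP; exists [:: f] => //;
  exact: subfield_f.
have bP k : P k -> (k <= c)%N by move=> /asboolP[l hl <-]; exact: subfield_bounded.
case: (ex_maxnP exP bP) => k /asboolP[l hl sl] maxk.
by exists l; split=> // l' hl'; rewrite sl; apply: maxk; apply/asboolP; exists l'.
Qed.

Lemma algebraic_powers d : corner d -> d != 0 -> exists n, forall N,
  sp [seq d ^+ j * f | j <- iota 0 n] (d ^+ N * f).
Proof.
move=> Dd d0; have [Bd fd df] := Dd; have Md := corner_M Dd.
have /rideal1[w [Bw ef]] := Mf.
have dy0 : d * y != 0.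
  by apply: contra_neq d0 => dy0; rewrite -df ef mulrA dy0 mul0r.
have [p [p0 py]] := algM Md dy0.
have pf : horner_alg d p * f = 0 by rewrite ef mulrA py mul0r.
pose n := (size p).-1; exists n; set pw := map _ _.
have pwn j : (j < n)%N -> sp pw (d ^+ j * f).
  by move=> jn; apply: sp_mem; apply/mapP; exists j; rewrite ?mem_iota.
have sn : size p = n.+1 by rewrite /n prednK // size_poly_gt0.
have dn : sp pw (d ^+ n * f).
  have : sp pw (p`_n *: (d ^+ n * f)).
    have := pf; rewrite -[p in horner_alg d p]coefK poly_def rmorph_sum mulr_suml sn.
    rewrite big_ord_recr /= => /eqP; rewrite addrC addr_eq0 => /eqP.
    rewrite !linearZ /= mulr_algl rmorphXn /= horner_algX scalerAl => ->.
    apply: subspN => //; apply: subsp_sum => // i _.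
    rewrite linearZ /= mulr_algl rmorphXn /= horner_algX -scalerAl.
    by apply: subspZ => //; exact: pwn.
  move=> /(subspZ (p`_n)^-1 (sp_subsp _)); rewrite scalerA mulVf ?scale1r //.
  by rewrite -[n]/((size p).-1) -lead_coefE lead_coef_eq0.
elim=> [|N IH].
  case: (posnP n) => n0; first by move: dn; rewrite n0.
  exact: pwn.
rewrite exprS -mulrA; move: IH.
apply: (spn_min (P := [set z | sp pw (d * z)])).
- exact: subsp_mull.
- by move=> _ -> /=; rewrite mulr0; exact: subsp0.
move=> _ /mapP[j + ->] /=; rewrite mem_iota add0n mulrA -exprS => jn.
by case: (ltngtP j.+1 n) jn => // [/pwn//|->].
Qed.

(** Otherwise l and the powers of d span a larger subfield, finite-dimensional
    because d is algebraic. *)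
Lemma centralizer_maximal l d : subfield l ->
  (forall l', subfield l' -> (size l' <= size l)%N) -> corner d ->
  (forall x, x \in l -> d * x = x * d) -> sp l d.
Proof.
move=> hl maxl Dd dl; have [Bd fd df] := Dd.
case: (eqVneq d 0) => [->|d0]; first exact: subsp0.
apply: contrapT => ld; have [n hn] := algebraic_powers Dd d0.
pose p j := d ^+ j * f; set pw := [seq p j | j <- iota 0 n] in hn.
have fp j : f * p j = p j.
  by case: j => [|j]; rewrite /p ?expr0 ?mul1r ?f_idem // exprS !mulrA fd.
have pf j : p j * f = p j by rewrite /p -mulrA f_idem.
have pD i j : p i * p j = p (i + j)%N.
  by rewrite {1}/p -mulrA fp /p mulrA exprD.
have Dp j : corner (p j).
  elim: j => [|j IH]; first by rewrite /p expr0 mul1r.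
  by rewrite /p exprS -mulrA; exact: corner_mul.
have pC x j : x \in l -> p j * x = x * p j.
  move=> xl; have [Bx fx xf] := subfieldD hl xl; rewrite /p -mulrA fx.
  elim: j => [|j IH]; first by rewrite !expr0 !mul1r xf.
  by rewrite exprS -mulrA IH !mulrA dl.
have pM u v i j : v \in l -> u * p i * (v * p j) = u * v * p (i + j)%N.
  by move=> vl; rewrite mulrA -[u * p i * v]mulrA pC // mulrA -mulrA pD.
pose l' := products l pw.
have l'1 x : x \in l -> sp l' x.
  move=> xl; have [_ _ <-] := subfieldD hl xl; apply: sp_products;
    first exact: sp_mem.
  by have := hn 0%N; rewrite expr0 mul1r.
have l'f : sp l' f by apply: sp_sub (subfield1 hl).
have l'd : sp l' d.
  rewrite -fd; apply: sp_products; first exact: subfield1.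
  by have := hn 1%N; rewrite expr1 df.
have l'D x : x \in l' -> corner x.
  move: x; apply: products_ind => x z /(subfieldD hl) Dx /mapP[j _ ->];
    exact: corner_mul.
have l'C x z : x \in l' -> z \in l' -> x * z = z * x.
  move=> /allpairsP[[u _] /= [ul /mapP[i _ ->] ->]] /allpairsP[[v _] /= [vl /mapP[j _ ->] ->]].
  by rewrite !pM // addnC (subfieldC hl ul vl).
have l'M x z : x \in l' -> z \in l' -> sp l' (x * z).
  move=> /allpairsP[[u _] /= [ul /mapP[i _ ->] ->]] /allpairsP[[v _] /= [vl /mapP[j _ ->] ->]].
  by rewrite pM //; apply: sp_products; [exact: (subfieldM hl)|exact: hn].
have [t [tl' it st ht]] := rk_basis l' subsp_zero.
have : (size (d :: l) <= size t)%N.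
  rewrite st; apply: indep_rk => //; first by split=> //; exact: subfield_indep.
  by move=> x /[!inE] /predU1P[->|/l'1].
rewrite ltnNge maxl //; split=> [x /tl'/l'D//|x z /tl' xl /tl' zl|x z /tl' xl /tl' zl||//].
- exact: l'C.
- by apply: ht; exact: l'M.
- exact: ht.
Qed.

(** * Finiteness of the corner *)

Lemma sum_lift n (i0 : 'I_n.+1) (E : 'I_n.+1 -> Q) :
  \sum_i E i = E i0 + \sum_j E (lift i0 j).
Proof. by rewrite (bigD1_ord i0). Qed.

(** Gaussian elimination for q homogeneous equations in q + 1 unknowns on the
    right, over the division ring f B f. *)
Lemma corner_solve q (a : 'I_q -> 'I_q.+1 -> Q) : (forall k i, corner (a k i)) ->
  exists g : 'I_q.+1 -> Q, [/\ forall i, corner (g i), exists i, g i != 0 &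
    forall k, \sum_i a k i * g i = 0].
Proof.
elim: q a => [|q IH] a Da.
  by exists (fun=> f); split=> [i||[]//] //; exists ord0; exact: f_neq0.
have [i0 [w [Dw hw]]] : exists i0 w, corner w /\
    forall i, a ord_max i0 * w * a ord_max i = a ord_max i.
  case: (EM (exists i0, a ord_max i0 != 0)) => [[i0 nz]|h].
    have [w [Dw aw _]] := corner_inv (Da _ _) nz.
    by exists i0, w; split=> // i; rewrite aw; case: (Da ord_max i).
  (* the last equation is trivial: set the unknown 0 to zero, pivoting with 0 *)
  exists ord0, 0; split=> [|i]; first exact: (subsp0 corner_subsp).
  rewrite mulr0 mul0r; apply/eqP; rewrite eq_sym; apply: contrapT => /negP nz.
  by apply: h; exists i.
have DB x z : corner x -> corner z -> corner (x - z) by move=> ? ?;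
  exact: (subspB corner_subsp).
have [k i|g [Dg [i gi] hg]] := IH (fun k j => a (lift ord_max k) (lift i0 j) -
    a (lift ord_max k) i0 * w * a ord_max (lift i0 j)).
  by apply: DB => //; do 2?apply: corner_mul.
pose S := \sum_j a ord_max (lift i0 j) * g j.
have DS : corner S by apply: (subsp_sum _ corner_subsp) => j _; exact: corner_mul.
(* back substitution for the pivot i0 *)
exists (fun i => if unlift i0 i is Some j then g j else - (w * S)); split.
- by move=> j; case: unlift => //; apply: (subspN corner_subsp); exact: corner_mul.
- by exists (lift i0 i); rewrite liftK.
move=> k; rewrite (sum_lift i0) unlift_none; under eq_bigr do rewrite liftK.
case: (unliftP ord_max k) => [k'|] ->; last first.
  rewrite mulrN -/S; apply/eqP; rewrite addrC subr_eq0 mulrA {2}/S mulr_sumr.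
  by apply/eqP/eq_bigr => j _; rewrite mulrA hw.
rewrite -[RHS](hg k') mulrN mulrA /S mulr_sumr -sumrN -big_split.
by apply: eq_bigr => j _ /=; rewrite mulrBl !mulrA addrC.
Qed.

Section Dedekind.
Variable l : seq Q.
Hypothesis hl : subfield l.

(** Independence of xs over the field L, for the action of L on the right. *)
Fixpoint dindep (xs : seq Q) : Prop :=
  if xs is x :: xs' then ~ sp (products xs' l) x /\ dindep xs' else True.

Lemma dindep0 xs (g : nat -> Q) : (forall x, x \in xs -> corner x) -> dindep xs ->
  (forall i, sp l (g i)) -> \sum_(i < size xs) xs`_i * g i = 0 ->
  forall i, (i < size xs)%N -> g i = 0.
Proof.
elim: xs g => //= x xs IH g Dxs [hx hxs] hg; rewrite big_ord_recl /= => e.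
have g0 : g 0%N = 0.
  apply/eqP; apply: contrapT => /negP nz; apply: hx.
  have [v [lv gv]] := sp_inv hl (hg 0%N) nz.
  have [_ _ <-] := Dxs x (mem_head _ _); rewrite -gv mulrA.
  move/eqP: e; rewrite addr_eq0 => /eqP->; rewrite mulNr; apply: subspN => //.
  rewrite mulr_suml; apply: subsp_sum => // i _; rewrite -mulrA.
  by apply: sp_products; [exact/sp_mem/mem_nth/ltn_ord|exact: (sp_mul hl)].
move=> [//|i] iS; apply: (IH (fun i => g i.+1)) => //.
  by move=> z zs; apply: Dxs; rewrite inE zs orbT.
by move: e; rewrite g0 mulr0 add0r.
Qed.

Definition dsol q (xs : seq Q) (g : 'I_q -> Q) := [/\ forall i, corner (g i),
  exists i, g i != 0 & forall m, sp l m -> \sum_(i < q) xs`_i * m * g i = 0].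

Hypothesis maxl : forall l', subfield l' -> (size l' <= size l)%N.

(** Dedekind: take a solution of minimal support, normalized so that one entry is
    f.  For x in L the commutators of its entries with x form a solution of
    smaller support, so they vanish, and the entries lie in the centralizer of L,
    which is L. *)
Lemma dsol_commuting q xs (g : 'I_q -> Q) : dsol xs g -> exists h : 'I_q -> Q,
  [/\ forall i, sp l (h i), exists i, h i != 0 & \sum_(i < q) xs`_i * h i = 0].
Proof.
pose supp (g : 'I_q -> Q) := #|[pred i | g i != 0]|.
pose P n := `[< exists2 g, dsol xs g & supp g = n >].
move=> hg; have exP : exists n, P n by exists (supp g); apply/asboolP; exists g.
case: (ex_minnP exP) => n /asboolP[{hg}g [Dg [i0 gi0] hg] sg] minn.
have [w [Dw gw wg]] := corner_inv (Dg i0) gi0.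
have w0 : w != 0 by apply: contra_neq f_neq0 => w0; rewrite -gw w0 mulr0.
pose h i := g i * w.
have hi0 : h i0 = f by [].
have hs m : sp l m -> \sum_(i < q) xs`_i * m * h i = 0.
  by move=> lm; under eq_bigr do rewrite mulrA; rewrite -mulr_suml hg // mul0r.
have commh x i : x \in l -> h i * x = x * h i.
  move=> xl; have [Bx fx xf] := subfieldD hl xl; apply/eqP; rewrite -subr_eq0.
  apply: contrapT => /negP nz; pose k j := h j * x - x * h j.
  suff /minn : P (supp k).
    apply/negP; rewrite -ltnNge -sg; apply: proper_card; apply/properP; split.
      apply/fintype.subsetP => j; rewrite !inE; apply: contra_neq => gj.
      by rewrite /k /h gj !mul0r mulr0 subrr.
    by exists i0; rewrite !inE // /k hi0 fx xf subrr eqxx.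
  apply/asboolP; exists k => //; split; last first.
  - move=> m lm; under eq_bigr do rewrite mulrBr.
    rewrite sumrB; apply/eqP; rewrite subr_eq0; apply/eqP.
    transitivity (\sum_(i < q) (xs`_i * m * h i) * x);
      first by apply: eq_bigr => j _; rewrite !mulrA.
    rewrite -mulr_suml hs // mul0r; apply/esym.
    under eq_bigr do rewrite mulrA -[_ * m * x]mulrA.
    by apply: hs; apply: (sp_mul hl) => //; exact: sp_mem.
  - by exists i.
  - move=> j; have Dh : corner (h j) by exact: corner_mul.
    by apply: (subspB corner_subsp); apply: corner_mul => //; exact: (subfieldD hl).
exists h; split.
- by move=> i; apply: centralizer_maximal => // [|x xl];
  [exact: corner_mul|exact: commh].
- by exists i0; rewrite hi0 f_neq0.
rewrite -[RHS](hs f (subfield1 hl)); apply: eq_bigr => i _.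
by rewrite -mulrA; have [_ -> _] : corner (h i) by exact: corner_mul.
Qed.
End Dedekind.

(** Let q be the degree of a maximal subfield L.  For q + 1 elements x_i the
    system of [dsol] reduces to q equations, so it has a solution; by
    [dsol_commuting] it has one in L, which is a dependence relation over L. *)
Lemma corner_finite : exists e : seq Q, (forall x, x \in e ->
  corner x) /\ forall x, corner x -> sp e x.
Proof.
have [l [hl maxl]] := maximal_subfield.
apply: contrapT => h.
have grow q : exists xs : seq Q, [/\ size xs = q, dindep l xs & forall x,
  x \in xs -> corner x].
  elim: q => [|q [xs [sq ti hxs]]]; first by exists [::].
  have [x Dx nx] : exists2 x, corner x & ~ sp (products xs l) x.
    apply: contrapT => hx; apply: h; exists (products xs l); split.
      by apply: products_ind => u v /hxs ? /(subfieldD hl) ?; exact: corner_mul.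
    by move=> x Dx; apply: contrapT => nx; apply: hx; exists x.
  exists (x :: xs); split=> //=; first by rewrite sq.
  by move=> m /[!inE] /predU1P[->//|/hxs].
have [xs [sxs ti hxs]] := grow (size l).+1.
have Dx (i : 'I_(size l).+1) : corner xs`_i by apply: hxs; rewrite mem_nth ?sxs.
have [k i|g [Dg gnz hg]] := @corner_solve (size l) (fun k i => xs`_i * l`_k).
  by apply: corner_mul => //; apply: (subfieldD hl); exact: mem_nth.
have [|k [lk [i ki] hk]] := @dsol_commuting l hl maxl _ xs g.
  split=> // m /sp_coef[d ->]; under eq_bigr do rewrite mulr_sumr mulr_suml.
  rewrite exchange_big big1 //= => j _.
  under eq_bigr do rewrite -scalerAr -scalerAl.
  by rewrite -scaler_sumr hg scaler0.
case/negP: ki; apply/eqP.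
have := @dindep0 l hl xs (fun i => k (inord i)) hxs ti.
rewrite sxs => /(_ (fun i => lk _)) /(_ _ i (ltn_ord i)); rewrite inord_val; apply.
by rewrite -[RHS]hk; apply: eq_bigr => j _; rewrite inord_val.
Qed.

(** * Contradiction in the algebraic case *)

Lemma deep_f : deep f.
Proof. by have /rideal1[b [Bb ->]] := Mf; exact: deepM. Qed.

(** f = f^n has depth n in a degree linear in n, so infinite rows would produce
    n^2 independent elements of depth n in degree O(n). *)
Lemma f_stable_row : exists i n, stable (left_row f i) (rows_below f i) n.
Proof.
apply: contrapT => h; have [d [s [hs sf]]] := deep_f.
have fk k : (0 < k)%N -> sp (s ^^ k) f.
  case: k => // k _; elim: k => [|k IH].
    by apply: spS sf => z; rewrite monomials1.
  by rewrite -f_idem; exact: sp_products.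
pose n := (C * (d + 2) ^ 2).+1.
have [i m hi|t [st it ht]] := @unstable_rows f _ n; first by apply: h; exists i, m.
pose L := products (products (V ^^ n) (s ^^ n)) (V ^^ n).
have : (size t <= rank_mod zero_sp L)%N.
  apply: indep_rk => // x /ht; move: x; apply: products_ind => z v zf vn.
  apply: sp_products; last exact: sp_mem.
  move: z zf; apply: products_ind => u _ un /[!inE] /eqP->.
  by apply: sp_products; [exact: sp_mem|exact: fk].
have GL x : x \in L -> G n (n + d * n + n) x.
  by move: x; apply: G_productsV; apply: (@G_products 0 n);
    [exact: G0|exact: G_monomials].
have := @Gdim n (n + d * n + n)%N L isT GL; rewrite st.
have -> : (n + d * n + n = (d + 2) * n)%N by lia.
rewrite expnMn -mulnn => H1 H2.
have : (n.+1 * (n * n) <= C * ((d + 2) ^ 2 * (n * n)))%N.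
  by apply: leq_trans H1; rewrite leq_mul2l H2 orbT.
by rewrite (mulnA C) leq_pmul2r ?muln_gt0 // /n ltnNge leqnSn.
Qed.

(** Put R = V^i f B with V^(i+1) f B / R finite-dimensional.  For v in V^(i+1) the
    module v f B is an image of the simple module f B: if it is not inside R it
    meets R in 0 and is infinite-dimensional modulo R.  So R is a left ideal, it
    contains B f, and B f = B f f lies in V^i f B f. *)
Lemma corner_left_ideal : exists e : seq Q, [/\ forall x, x \in e -> x * f = x,
  forall x, x \in e -> B x & forall b, B b -> sp e (b * f)].
Proof.
have [i [n hst]] := stable_row subalg_f f_neq0 f_stable_row.
set R := rideal (left_row f i) in hst.
have hR v : v \in V ^^ i.+1 -> R (v * f).
  move=> vi; apply: contrapT => nvf.
  have Rvm m : M m -> R (v * m) -> m = 0.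
    move=> Mm Rvm; apply/eqP; apply: contrapT => /negP m0; apply: nvf.
    have : rideal [:: m] f.
      apply: rideal_min Mf => // u /[!inE] /eqP->; exact: M_minimal.
    by case/rideal1=> b [Bb ->]; rewrite mulrA; exact: rideal_mulr.
  have ns k : ~ stable [:: v * f] R k.
    move=> h; apply: (@not_stable1 f k subalg_f f_neq0); apply: products_ind =>
      _ w /[!inE] /eqP-> wk.
    have [z fz Rz] : exists2 z, sp (products [:: f] (V ^^ k)) z &
      R (v * f * w - v * z).
      have := h _ (mem_products (mem_head _ _) wk).
      rewrite /products /= !cats0; elim: (V ^^ k) (v * f * w) => [|u s IH] x /=.
        by move=> Rx; exists 0; [exact: subsp0|rewrite mulr0 subr0].
      move=> [a /IH[z sz Rz]]; exists (a *: (f * u) + z).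
        by exists a; rewrite addrC addKr.
      by rewrite mulrDr -scalerAr opprD addrA [v * (f * u)]mulrA.
    have Mz : M z.
      move: fz; apply: (spn_min (P := M)) => // [_ ->|]; first exact: subsp0.
      apply: products_ind => _ u /[!inE] /eqP-> /subalg_monomials Bu;
        exact: rideal_mulr.
    have /eqP : f * w - z = 0.
      apply: Rvm; last by rewrite mulrBr mulrA.
      by apply: subspB => //; apply: rideal_mulr => //; exact: subalg_monomials wk.
    by rewrite subr_eq0 => /eqP->.
  have [t [st it ht]] := rows (@rideal_subsp _) ns (size (products (left_row f i.+1) (V ^^ n))).+1.
  have := indep_size (@rideal_subsp _) it (t := products (left_row f i.+1) (V ^^ n)).
  rewrite st ltnn => /(_ _)/negP; apply => // x /ht/rideal_products hx.
  apply: stable_rideal => //; apply: rideal_min hx => // u /[!inE] /eqP->.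
  by apply: rideal_mem; apply: mem_products; rewrite ?inE.
have RV v x : v \in V -> R x -> R (v * x).
  move=> Vv; apply: (rideal_min (W := [set x | R (v * x)])).
    split; first exact/subsp_mull/rideal_subsp.
    by move=> z b /= Rz Bb; rewrite mulrA; exact: rideal_mulr.
  apply: products_ind => u _ ui /[!inE] /eqP-> /=; rewrite mulrA; apply: hR.
  exact: mem_products.
have RB b x : B b -> R x -> R (b * x).
  move=> [m bm] Rx; apply: (spn_min (P := [set b | R (b * x)])) bm.
  - exact/subsp_mulr/rideal_subsp.
  - by move=> _ -> /=; rewrite mul0r; exact: (subsp0 (@rideal_subsp _)).
  elim: m => [|m IH] z; first by rewrite inE => /eqP-> /=; rewrite mul1r.
  by case/allpairsP=> -[v w] /= [Vv /IH Rw ->]; rewrite -mulrA; exact: RV.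
have Rf : R f.
  by apply: rideal_mem; exact: left_row_self.
have [e [eD De]] := corner_finite; exists (products (V ^^ i) e); split.
- by apply: products_ind => v d _ /eD[_ _ df]; rewrite -mulrA df.
- by apply: products_ind => v d /subalg_monomials Bv /eD[Bd _ _]; exact: subalgM.
move=> b Bb; rewrite -f_idem mulrA; have := RB b f Bb Rf.
case=> k; apply: (spn_min (P := [set z | sp (products (V ^^ i) e) (z * f)])).
- exact: subsp_mulr.
- by move=> _ -> /=; rewrite mul0r; exact: subsp0.
apply: products_ind => z w zi /subalg_monomials Bw /=.
move: z zi; apply: products_ind => v _ vi /[!inE] /eqP->; rewrite -!mulrA.
apply: sp_products; first exact: sp_mem.
apply: De; split; first by do 2?apply: subalgM.
  by rewrite mulrA f_idem.
by rewrite -!mulrA f_idem.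
Qed.

(** B acts on the finite-dimensional left ideal B f, faithfully because B is
    prime. *)
Lemma corner_contradiction : False.
Proof.
have [e [ef Be he]] := corner_left_ideal.
apply: (@faithful_infinite (size e) e (fun j => e`_j \o* idfun)) =>
  [b j Bb|b Bb hb] /=.
  have ej : e`_j \in e by exact: mem_nth.
  rewrite -(ef _ ej) mulrA; apply: he; apply: subalgM => //; exact: Be.
have [|//|f0] := @prime0 b f Bb subalg_f; last by have := f_neq0; rewrite f0 eqxx.
move=> d Bd; rewrite -mulrA; have /sp_coef[a ->] := he d Bd.
rewrite mulr_sumr big1 // => j _; have /= h := hb j.
by rewrite -scalerAr h scaler0.
Qed.
End Algebraic.
End Critical.
End Filtration.

Section DeepGrowth.
Variables (F : fieldType) (Q : algType F) (V : seq Q) (G : nat -> nat ->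
  set Q) (C : nat).
Notation B := (subalg V).

(** If B is finite-dimensional it satisfies a standard identity by counting;
    otherwise the two cases of the critical right ideal y B apply. *)
Theorem deep_growth_PI :
  1 \in V ->
  (forall x y, B x -> B y -> x != 0 -> y != 0 ->
     exists n b, b \in monomials V n /\ x * b * y != 0) ->
  (forall n x, x \in monomials V n -> G 0 n x) ->
  (forall k l m n x y, G k m x -> G l n y -> G (k + l) (m + n) (x * y)) ->
  (forall k l m n x, (l <= k)%N -> (m <= n)%N -> G k m x -> G l n x) ->
  (forall k n x, G k n x -> B x) ->
  (forall k n s, (0 < n)%N -> (forall x, x \in s -> G k n x) ->
     (k.+1 * rank_mod zero_sp s <= C * n ^ 2)%N) ->
  (exists d x, x != 0 /\ G 1 d x) ->
  exists N, forall b : 'I_N -> Q, (forall i, B (b i)) -> stdpoly b = 0.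
Proof.
move=> V1 pB G0 GM GW GB Gdim G1; apply: contrapT => nPI.
have Binf e : exists2 b, B b & ~ span_mod zero_sp e b.
  apply: contrapT => h; apply: nPI; exists (size e).+1 => b Bb.
  have /choice[a ha] i : exists a : 'I_(size e) -> F, b i = \sum_j a j *: e`_j.
    by apply: sp_coef; apply: contrapT => nb; apply: h; exists (b i).
  have -> : b = fun i => \sum_j a i j *: e`_j by apply/funext.
  by apply: stdpoly_spanned; rewrite card_ord.
have [y [c [y0 dy gy crit]]] := critical V1 Binf pB G0 GM GW GB Gdim G1.
have algM u : rideal V [:: y] u -> u * y != 0 ->
    exists p : {poly F}, p != 0 /\ horner_alg u p * y = 0.
  move=> Mu uy; apply: contrapT => h; apply: nPI.
  apply: (transcendental_PI V1 Binf pB GB y0 dy gy crit Mu) => // p p0.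
  by apply/eqP => py; apply: h; exists p.
have [f [Mf fM]] := idempotent_exists V1 Binf pB GB y0 dy crit algM.
exact: (corner_contradiction V1 Binf pB G0 GM GB Gdim y0 dy gy crit algM Mf fM).
Qed.
End DeepGrowth.

(** * Prime rings and their Martindale quotient *)

Section PrimeRing.
Variables (A : nzRingType) (pA : prime_ring A).
Implicit Types (L : set A) (x y : A).

Lemma is_ideal_eq0 L : is_ideal L -> (forall x, L x -> x = 0) -> L = [set 0].
Proof.
by move=> [L0 _ _ _] h; apply/seteqP; split=> [x /h->|_ ->].
Qed.

Lemma prime_lann L c : nonzero_ideal L -> (forall y, L y -> c * y = 0) -> c = 0.
Proof.
move=> [iL L0] h; have [_ LD Ll Lr] := iL.
have [|||J0|//] := pA (I := [set x | forall y, L y -> x * y = 0]) (J := L).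
- split=> [y _|x z hx hz y Ly|a x hx y Ly|a x hx y Ly]; first by rewrite mul0r.
  + by rewrite mulrDl hx // hz // addr0.
  + by rewrite -mulrA hx // mulr0.
  + by rewrite -mulrA hx //; exact: Ll.
- exact: iL.
- apply/seteqP; split=> [a|_ ->]; last exact: ideal_mul0.
  by case=> n [x [y [xy ->]]]; apply: big1 => i _; case: (xy i) => hx /hx.
have : [set x | forall y, L y -> x * y = 0] c by [].
by rewrite J0.
Qed.

(** The two-sided ideals J = { u | u A y = 0 } and L = { w | J A w = 0 } satisfy
    J L = 0. *)
Lemma prime_elt x y : x != 0 -> y != 0 -> exists a, x * a * y != 0.
Proof.
move=> x0 y0; apply: contrapT => h.
have xay a : x * a * y = 0.
  by apply/eqP; apply: contrapT => /negP nz; apply: h; exists a.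
pose J := [set u | forall a, u * a * y = 0].
pose L := [set w | forall u a, J u -> u * a * w = 0].
have [|||J0|L0] := pA (I := J) (J := L).
- split=> [a|u v hu hv a|b u hu a|b u hu a]; first by rewrite !mul0r.
  + by rewrite !mulrDl hu hv addr0.
  + by rewrite -!mulrA [u * _]mulrA hu mulr0.
  + by rewrite -[u * b * a]mulrA hu.
- split=> [u a _|v w hv hw u a Ju|b w hw u a Ju|b w hw u a Ju];
  first by rewrite mulr0.
  + by rewrite mulrDr hv // hw // addr0.
  + by rewrite mulrA -[u * a * b]mulrA hw.
  + by rewrite mulrA hw // mul0r.
- apply/seteqP; split=> [a|_ ->]; last exact: ideal_mul0.
  case=> n [u [w [uw ->]]]; apply: big1 => i _; case: (uw i) => Ju Lw.
  by rewrite -[u i]mulr1; exact: Lw.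
- have : J x by [].
  by rewrite J0 => /= x0'; rewrite x0' eqxx in x0.
have : L y by move=> u a; exact.
by rewrite L0 => /= y0'; rewrite y0' eqxx in y0.
Qed.
End PrimeRing.

Section ExtendedCentre.
Variables (K : fieldType) (A : algType K) (pA : prime_ring A).
Notation Q := (martindale pA).
Notation mlmul := (mlmul pA).
Implicit Types (p q : mpair A).

Lemma mulE (u v : Q) : u * v = mmul u v. Proof. by []. Qed.

Lemma mlmulM (a b : A) : mlmul (a * b) = mlmul a * mlmul b.
Proof.
by rewrite mulE mmul_pi; apply: mequiv_of_fun => x /=; rewrite mulrA.
Qed.

Lemma mlmulP (k : K) (a b : A) : mlmul (k *: a + b) = k *: mlmul a + mlmul b.
Proof.
rewrite -[RHS]/(madd (mscale k (mlmul a)) (mlmul b)) mscale_pi madd_pi.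
by apply: mequiv_of_fun => x /=; rewrite mulrDl scalerAl.
Qed.

HB.instance Definition _ := GRing.isLinear.Build K A Q _ (mlmul : A -> Q) mlmulP.
HB.instance Definition _ := GRing.isMonoidMorphism.Build A Q (mlmul : A -> Q)
  (erefl, mlmulM).

Lemma mlmul_inj a : mlmul a = 0 -> a = 0.
Proof.
move=> /eqP/mequivP[L [L0 _ e]]; apply: (prime_lann pA L0) => y /e /= ->.
by rewrite mul0r.
Qed.

(** The product in the Martindale ring extends the evaluation of its elements. *)
Lemma mpi_mlmul p x : mdom p x -> \pi_Q p * mlmul x = mlmul (mfun p x).
Proof.
move=> px; rewrite mulE mmul_pi; apply/eqP/mequivP.
exists (ideal_mul setT (mdom p)); split;
  first exact: nonzero_ideal_mul (nonzero_idealT A) (mdomP p).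
  by move=> y hy; split.
by move=> b _ /=; case: (mfunP p) => _ ->.
Qed.

Lemma mpi_eq0 p : (forall x, mdom p x -> mfun p x = 0) -> \pi_Q p = 0.
Proof.
move=> h; apply/eqP/mequivP; exists (mdom p); split; [exact: mdomP|by []|].
by move=> x /h /= ->; rewrite mul0r.
Qed.

(** A nonzero element is represented by a map that is nonzero somewhere. *)
Lemma mul_into_ring (q : Q) : q != 0 -> exists l a : A,
  a != 0 /\ q * mlmul l = mlmul a.
Proof.
elim/martindaleW: q => p p0; apply: contrapT => h; case/negP: p0; apply/eqP/mpi_eq0.
move=> x px; apply/eqP; apply: contrapT => /negP nz; apply: h.
by exists x, (mfun p x); split=> //; exact: mpi_mlmul.
Qed.

Lemma martindale_prime (u v : Q) : u != 0 -> v != 0 -> exists a : A,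
  u * mlmul a * v != 0.
Proof.
move=> /mul_into_ring[l [x [x0 ul]]] /mul_into_ring[m [y [y0 vm]]].
have [a xay] := prime_elt pA x0 y0; exists (l * a); apply: contra_neq xay => h.
apply: mlmul_inj; rewrite !rmorphM /= -ul -vm.
by rewrite -[u * _ * _]mulrA -mlmulM mulrA h mul0r.
Qed.

(** Commuting with the left multiplication by a gives the identity on some ideal
    L; right linearity gives it up to left annihilators of L, which are 0. *)
Lemma centre_bimodule p : extended_centre (\pi_Q p) ->
  forall a x, mdom p x -> mfun p (a * x) = a * mfun p x.
Proof.
move=> cp a x px; have [[_ _ pl pr] _] := mdomP p; have [_ fM] := mfunP p.
have := cp (mlmul a); rewrite !mulE !mmul_pi => /eqP/mequivP[L [L0 _ e]].
apply/eqP; rewrite -subr_eq0; apply/eqP/(prime_lann pA L0) => y Ly.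
have [_ _ Ll _] := L0.1; have := e _ (Ll x y Ly) => /= h.
rewrite mulrBl -fM; last exact: pl.
by rewrite -!mulrA -fM // h subrr.
Qed.

(** The kernel and the image of a map of bimodules are ideals, with product 0. *)
Lemma centre_inj p : extended_centre (\pi_Q p) -> \pi_Q p != 0 ->
  forall x, mdom p x -> mfun p x = 0 -> x = 0.
Proof.
move=> cp p0 x px fx; have [[I0 ID Il Ir] _] := mdomP p; have [fD fM] := mfunP p.
have fl := centre_bimodule cp; have f0 := right_linear0 (mdomP p).1 (mfunP p).
pose J := [set u | mdom p u /\ mfun p u = 0]; pose L := mfun p @` mdom p.
have iJ : is_ideal J.
  split=> [//|u v [pu u0] [pv v0]|a u [pu u0]|a u [pu u0]].
  - by split; [exact: ID|rewrite fD // u0 v0 addr0].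
  - by split; [exact: Il|rewrite fl // u0 mulr0].
  - by split; [exact: Ir|rewrite fM // u0 mul0r].
have iL : is_ideal L.
  split.
  - by exists 0.
  - by move=> _ _ [u pu <-] [v pv <-]; exists (u + v); [exact: ID|exact: fD].
  - by move=> a _ [u pu <-]; exists (a * u); [exact: Il|exact: fl].
  - by move=> a _ [u pu <-]; exists (u * a); [exact: Ir|exact: fM].
have [|J0|L0] := pA iJ iL.
- apply/seteqP; split=> [a|_ ->]; last exact: ideal_mul0.
  case=> n [u [w [uw ->]]]; apply: big1 => i _; case: (uw i) => -[pu u0] [v pv <-].
  by rewrite -fl // fM // u0 mul0r.
- have : J x by [].
  by rewrite J0.
case/negP: p0; apply/eqP/mpi_eq0 => u pu.
have : L (mfun p u) by exists u.
by rewrite L0.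
Qed.

(** The inverse map is defined on the image, which is an ideal; any values may be
    chosen outside. *)
Lemma centre_inverse (z : Q) : extended_centre z -> z != 0 ->
  exists2 w : Q, extended_centre w & w * z = 1.
Proof.
elim/martindaleW: z => p cp p0; have inj := centre_inj cp p0.
have [[I0 ID Il Ir] _] := mdomP p; have [fD fM] := mfunP p.
have fl := centre_bimodule cp; have f0 := right_linear0 (mdomP p).1 (mfunP p).
pose L := mfun p @` mdom p.
have iL : nonzero_ideal L.
  split; first split.
  - by exists 0.
  - by move=> _ _ [u pu <-] [v pv <-]; exists (u + v); [exact: ID|exact: fD].
  - by move=> a _ [u pu <-]; exists (a * u); [exact: Il|exact: fl].
  - by move=> a _ [u pu <-]; exists (u * a); [exact: Ir|exact: fM].
  move=> L0; case/negP: p0; apply/eqP/mpi_eq0 => u pu.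
  have : L (mfun p u) by exists u.
  by rewrite L0.
pose g y := xget 0 [set x | mdom p x /\ mfun p x = y].
have gP y : L y -> mdom p (g y) /\ mfun p (g y) = y.
  by move=> [x px <-]; rewrite /g; case: xgetP => [_ _ //|/(_ x)[]].
have uniq x y : mdom p x -> mdom p y -> mfun p x = mfun p y -> x = y.
  move=> px py e; have pNy : mdom p (- y) by rewrite -mulN1r; exact: Il.
  apply/eqP; rewrite -subr_eq0; apply/eqP/inj; first exact: ID.
  by rewrite fD // -[- y]mulN1r fl // mulN1r e subrr.
have [_ LD Ll Lr] := iL.1.
have glin : right_linear_on L g.
  split=> [x y Lx Ly|x a Lx].
    have [[px fx] [py fy]] := (gP x Lx, gP y Ly).
    have [ps fs] := gP _ (LD _ _ Lx Ly).
    by apply: uniq => //; [exact: ID|rewrite fs fD // fx fy].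
  have [px fx] := gP x Lx; have [ps fs] := gP _ (Lr a x Lx).
  by apply: uniq => //; [exact: Ir|rewrite fs fM // fx].
pose w : Q := \pi_Q (MPair iL glin).
have zw : \pi_Q p * w = 1.
  rewrite mulE mmul_pi; apply/eqP/mequivP; exists (ideal_mul L (mdom p)); split.
  - exact: (nonzero_ideal_mul pA iL (mdomP p)).
  - by [].
  - by move=> x /(ideal_mul_subl iL.1) /gP[_ /= ->]; rewrite mul1r.
exists w; last by rewrite -cp.
move=> u; have wz : w * \pi_Q p = 1 by rewrite -cp.
rewrite -[w * u]mulr1 -zw mulrA -[w * u * _]mulrA -cp !mulrA wz mul1r //.
Qed.
End ExtendedCentre.

(** * The extended centre as a field of scalars *)

Section CentreField.
Variables (K : fieldType) (A : algType K) (pA : prime_ring A).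
Notation Q := (martindale pA).

Definition central : {pred Q} := fun z => `[< extended_centre z >].

Lemma centralP z : reflect (extended_centre z) (z \in central).
Proof. exact: asboolP. Qed.

Fact central_subring : subring_closed central.
Proof.
split=> [|x y /centralP hx /centralP hy|x y /centralP hx /centralP hy];
  apply/centralP => u.
- by rewrite mul1r mulr1.
- by rewrite mulrBl mulrBr hx hy.
- by rewrite -mulrA hy mulrA hx mulrA.
Qed.
HB.instance Definition _ := GRing.isSubringClosed.Build Q central central_subring.

Definition centre_field := {z : Q | central z}.
HB.instance Definition _ := SubChoice.on centre_field.
HB.instance Definition _ := [SubChoice_isSubNzRing of centre_field by <:].

Lemma centre_valP (c : centre_field) (u : Q) : val c * u = u * val c.
Proof. by have /asboolP := valP c; exact. Qed.

Fact centre_mulC : commutative (@GRing.mul centre_field).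
Proof. by move=> c d; apply: val_inj; rewrite !rmorphM /= centre_valP. Qed.
HB.instance Definition _ :=
  GRing.PzRing_hasCommutativeMul.Build centre_field centre_mulC.

Fact centre_inv_ex (c : centre_field) :
  exists d : centre_field, (c = 0 -> d = 0) /\ (c != 0 -> d * c = 1).
Proof.
have [->|c0] := eqVneq c 0; first by exists 0; split=> //; rewrite eqxx.
have /asboolP cc := valP c.
have [|w cw wc] := centre_inverse cc.
  by apply: contra_neq c0 => v0; apply: val_inj; rewrite v0 rmorph0.
exists (exist (fun z => central z) w (asboolT cw)); split=> [e|_];
  first by move: c0; rewrite e eqxx.
by apply: val_inj; rewrite rmorphM rmorph1.
Qed.
Definition centre_inv c := sval (cid (centre_inv_ex c)).
Fact centre_mulVf c : c != 0 -> centre_inv c * c = 1.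
Proof. by have [_ h] := svalP (cid (centre_inv_ex c)); exact: h. Qed.
Fact centre_inv0 : centre_inv 0 = 0.
Proof. by have [h _] := svalP (cid (centre_inv_ex 0)); exact: h. Qed.
HB.instance Definition _ :=
  GRing.ComNzRing_isField.Build centre_field centre_mulVf centre_inv0.

(** A copy of the Martindale ring, to carry a structure of algebra over its
    extended centre along with the given one over K. *)
Definition martindale_over_centre := Q.
HB.instance Definition _ := GRing.NzRing.on martindale_over_centre.

Definition cscale (c : centre_field) (u : martindale_over_centre) : martindale_over_centre := (val c : Q) * (u : Q).
Fact cscaleA c d u : cscale c (cscale d u) = cscale (c * d) u.
Proof. by rewrite /cscale rmorphM /= mulrA. Qed.
Fact cscale1 : left_id 1 cscale.
Proof. by move=> u; rewrite /cscale rmorph1 mul1r. Qed.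
Fact cscaleDr : right_distributive cscale +%R.
Proof. by move=> c u v; rewrite /cscale mulrDr. Qed.
Fact cscaleDl u : {morph cscale^~ u : c d / c + d}.
Proof. by move=> c d; rewrite /cscale rmorphD mulrDl. Qed.
HB.instance Definition _ := GRing.Zmodule_isLmodule.Build centre_field martindale_over_centre
  cscaleA cscale1 cscaleDr cscaleDl.
Fact cscaleAl c (u v : martindale_over_centre) : c *: (u * v) = c *: u * v.
Proof. exact: mulrA. Qed.
HB.instance Definition _ := GRing.Lmodule_isLalgebra.Build centre_field martindale_over_centre cscaleAl.
Fact cscaleAr c (u v : martindale_over_centre) : c *: (u * v) = u * (c *: v).
Proof.
by rewrite -[LHS]/((val c : Q) * (u * v)) -[RHS]/(u * ((val c : Q) * v)) !mulrA centre_valP.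
Qed.
HB.instance Definition _ := GRing.Lalgebra_isAlgebra.Build centre_field martindale_over_centre cscaleAr.

Definition in_centre (z : Q) (cz : extended_centre z) : centre_field :=
  exist (fun z => central z) z (asboolT cz).

Lemma in_centreE z (cz : extended_centre z) (x : martindale_over_centre) :
  in_centre cz *: x = (z : Q) * (x : Q).
Proof. by []. Qed.
End CentreField.

(** * Growth in terms of lists *)

Section GrowthBound.
Variables (R : realType) (K : fieldType) (A : algType K).
Implicit Types (s t : seq A) (S W : set A).
Notation sp := (span_mod zero_sp).

Lemma lin_span_min S W x : is_subspace W -> S `<=` W -> lin_span S x -> W x.
Proof.
move=> hW SW [n [c [v [Sv ->]]]]; apply: subsp_sum => // i _.
by apply: subspZ => //; exact: SW.
Qed.

Lemma sp_lin_span s S x : (forall y, y \in s -> S y) -> sp s x -> lin_span S x.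
Proof.
move=> h /sp_coef[c ->]; exists (size s), c, (fun i => s`_i); split=> // i.
by apply: h; exact: mem_nth.
Qed.

Lemma lin_span_sp s : lin_span [set a | a \in s] = [set x | sp s x].
Proof.
apply/seteqP; split=> x; last by apply: sp_lin_span.
apply: lin_span_min => [|y]; first exact/spn_subsp/subsp_zero.
exact/spn_mem/subsp_zero.
Qed.

Lemma has_dim_size W d t : has_dim W d -> indep_mod zero_sp t ->
  (forall x, x \in t -> W x) -> (size t <= d)%N.
Proof.
move=> [b [_ ->]] it h; have := indep_size subsp_zero it (t :=
  [seq b i | i <- enum 'I_d]).
rewrite size_map size_enum_ord; apply => x /h.
apply: lin_span_min => [|_ [i _ <-]]; first exact/spn_subsp/subsp_zero.
by apply/spn_mem/map_f; [exact: subsp_zero|rewrite mem_enum].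
Qed.

Lemma has_dim_span s : exists d, has_dim (lin_span [set a | a \in s]) d.
Proof.
have [t [ts it st hst]] := rk_basis s subsp_zero.
exists (size t), (fun i => t`_i); split; first by move=> c;
  exact: indep_coef subsp_zero it c.
rewrite lin_span_sp; apply/seteqP; split=> x /=.
  by move=> /hst /sp_coef[c ->]; exists (size t), c, (fun i => t`_i);
    split=> // i; exists i.
apply: lin_span_min => [|_ [i _ <-]]; first exact/spn_subsp/subsp_zero.
by apply/spn_mem/ts/mem_nth; [exact: subsp_zero|].
Qed.

Lemma monomials_prod s n x : x \in monomials s n ->
  exists v : 'I_n -> A, (forall i, v i \in s) /\ x = \prod_(i < n) v i.
Proof.
elim: n x => [|n IH] x.
  by rewrite inE => /eqP->; exists (fun=> 1); split=> [[]//|]; rewrite big_ord0.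
case/allpairsP=> -[u w] /= [us /IH[v [vs ->]] ->].
exists (fun i => if unlift ord0 i is Some j then v j else u); split=> [i|].
  by case: unlift.
by rewrite big_ord_recl unlift_none; congr (_ * _); apply: eq_bigr => i _;
  rewrite liftK.
Qed.

(** The elements reached by some power of the generators form a subalgebra. *)
Lemma generates_sp s : 1 \in s -> generates [set a | a \in s] ->
  forall a, exists n, sp (monomials s n) a.
Proof.
move=> s1 gen a; pose P : {pred A} := fun a => `[< exists n, sp (monomials s n) a >].
suff /asboolP : a \in P by [].
have mono m n x : (m <= n)%N -> sp (monomials s m) x -> sp (monomials s n) x.
  by move=> mn; apply: spnS => // [|y]; [exact: subsp_zero|exact: monomials_mono].
have ss t := spn_subsp t (@subsp_zero K A).
apply: gen => [|v vs]; last first.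
  by apply/asboolP; exists 1%N; apply: spn_mem;
    [exact: subsp_zero|rewrite monomials1].
split=> [|k x y /asboolP[m xm] /asboolP[n yn]|x y /asboolP[m xm] /asboolP[n yn]].
- by apply/asboolP; exists 0%N; apply: spn_mem; [exact: subsp_zero|rewrite inE].
- apply/asboolP; exists (maxn m n); apply: subspD => //;
  first by apply: subspZ => //; apply: mono xm; rewrite leq_maxl.
  by apply: mono yn; rewrite leq_maxr.
- apply/asboolP; exists (m + n)%N; apply: sp_products_ind xm yn => // u v um vn.
  by apply: spn_mem; [exact: subsp_zero|exact: monomialsD].
Qed.

Lemma quadratic_bound s : quadratic_growth A R -> 1 \in s ->
  generates [set a | a \in s] -> exists C : nat, forall n t, (0 < n)%N ->
  indep_mod zero_sp t -> (forall x, x \in t -> sp (monomials s n) x) ->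
    (size t <= C * n ^ 2)%N.
Proof.
move=> growth s1 gen; pose V := lin_span [set a | a \in s].
have sV x : x \in s -> V x by move=> xs; rewrite /V lin_span_sp;
  apply: spn_mem; [exact: subsp_zero|].
have [||C1 [C2 [_ C20 h]]] := growth V (has_dim_span s).
- exact: sV.
- by move=> P hP hV; apply: gen => // v vs; apply: hV; exact: sV.
have [C hC] : exists C : nat, C2 <= C%:R.
  by exists (Num.Def.archi_bound C2); apply/ltW/archi_boundP/ltW.
exists C => n t n0 it ht; have [d [hd /andP[_ dn]]] := h n n0.
apply: (@leq_trans d); first (apply: has_dim_size hd it _ => x /ht).
  apply: sp_lin_span => y /monomials_prod[v [vs ->]]; exists v; split=> // i;
    exact: sV.
rewrite -(ler_nat R) natrM natrX; apply/ltW/(lt_le_trans dn).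
by rewrite ler_wpM2r // exprn_ge0.
Qed.
End GrowthBound.

(** * The standard identity in the free algebra *)

Lemma rmorph_stdpoly (S T : nzRingType) (g : {rmorphism S -> T}) N (b : 'I_N -> S) :
  g (stdpoly b) = stdpoly (g \o b).
Proof.
rewrite rmorph_sum; apply: eq_bigr => s _.
by rewrite rmorphM rmorph_sign rmorph_prod.
Qed.

Section StandardPI.
Variables (K : fieldType) (A : algType K).

Definition std_word N (s : 'S_N) : {fmonom 'I_N} :=
  FMonom [seq s i | i <- index_enum 'I_N].

Lemma std_word_inj N : injective (@std_word N).
Proof.
move=> s t [] e; apply/permP => i.
by have /eq_in_map/(_ i) := e; apply; rewrite mem_index_enum.
Qed.

(** Distinct permutations give distinct words, so the standard polynomial of the
    free algebra is nonzero. *)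
Lemma stdpoly_satisfies_PI N : (forall b : 'I_N -> A, stdpoly b = 0) ->
  satisfies_PI A.
Proof.
move=> h; exists N, (\sum_(s : 'S_N) << (-1) ^+ s *g std_word s >>); split.
  apply/eqP => /(congr1 (mcoeff (std_word (1%g : 'S_N))));
    rewrite mcoeff0 raddf_sum /=.
  rewrite (bigD1 (1%g : 'S_N)) //= mcoeffUU big1 ?addr0;
    first by rewrite odd_perm1 => /eqP; rewrite oner_eq0.
  by move=> s s1; rewrite mcoeffU (inj_eq (@std_word_inj N)) (negPf s1).
move=> x; rewrite /nc_eval raddf_sum /= -[RHS](h x); apply: eq_bigr => s _.
by rewrite mmapU /= big_map mulr_algl sign_scale.
Qed.
End StandardPI.

(** * A transcendental element of the extended centre *)

Section TranscendentalCentre.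
Variables (K : fieldType) (A : algType K) (pA : prime_ring A).
Notation Q := (martindale pA).
Notation F := (centre_field pA).
Notation QF := (martindale_over_centre pA).
Notation mlmul := (mlmul pA : A -> Q).
Variables (z : Q) (cz : extended_centre z).
Hypothesis tz : forall p : {poly K}, p != 0 -> horner_alg z p != 0.
Variables (s : seq A) (C : nat).
Hypothesis s1 : 1 \in s.
Hypothesis gen : forall a : A, exists n, span_mod zero_sp (monomials s n) a.
Hypothesis bound : forall n (t : seq A), (0 < n)%N -> indep_mod zero_sp t ->
  (forall x, x \in t -> span_mod zero_sp (monomials s n) x) ->
    (size t <= C * n ^ 2)%N.

Definition image_gens : seq QF := map mlmul s.
Definition depth (k n : nat) (x : QF) : Prop := forall i, (i <= k)%N -> exists a : A,
  span_mod zero_sp (monomials s n) a /\ (z ^+ i * (x : Q) = mlmul a).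

Lemma monomials_mlmul n (x : QF) : x \in monomials image_gens n <-> exists2 a,
  a \in monomials s n & x = mlmul a.
Proof.
elim: n x => [|n IH] x.
  rewrite inE; split=> [/eqP->|[a /[!inE] /eqP-> ->]]; last by rewrite rmorph1.
  by exists 1; rewrite ?inE // rmorph1.
split=> [/allpairsP[[_ w] /= [/mapP[a sa ->] /IH[b bn ->] ->]]|[_ /allpairsP[[a b] /= [sa bn ->]] ->]].
  by exists (a * b); [exact: mem_products|rewrite rmorphM].
by rewrite rmorphM; apply: mem_products; [exact: map_f|apply/IH; exists b].
Qed.

Lemma scale_const (k : K) (x : Q) : exists c : F, (k *: x : QF) = c *: (x : QF).
Proof.
have ck : extended_centre (k%:A : Q) by move=> u; rewrite mulr_algl mulr_algr.
by exists (in_centre ck); rewrite in_centreE mulr_algl.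
Qed.

Lemma mlmul_span (W : set QF) (t : seq A) a : is_subspace W -> (forall b,
  b \in t -> W (mlmul b)) ->
  span_mod zero_sp t a -> W (mlmul a).
Proof.
move=> hW h; apply: (spn_min (P := [set a | W (mlmul a)])) => //.
  split=> [|k x y /= hx hy]; first by rewrite /= rmorph0; exact: (subsp0 hW).
  rewrite linearP /=; have [c e] := scale_const k (mlmul x).
  by apply: (subspD hW) => //; move: (subspZ c hW hx); rewrite -e.
by move=> _ -> /=; rewrite rmorph0; exact: (subsp0 hW).
Qed.

Lemma span_mlmul n a : span_mod zero_sp (monomials s n) a ->
  span_mod zero_sp (monomials image_gens n) (mlmul a : QF).
Proof.
apply: mlmul_span => [|b bn]; first exact/spn_subsp/subsp_zero.
by apply: spn_mem; [exact: subsp_zero|apply/monomials_mlmul; exists b].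
Qed.

Lemma subalg_mlmul a : subalg image_gens (mlmul a).
Proof. by have [n an] := gen a; exists n; exact: span_mlmul. Qed.

Lemma central_horner (p : {poly K}) : extended_centre (horner_alg z p).
Proof.
move=> u; elim/poly_ind: p => [|p k IH]; first by rewrite rmorph0 mul0r mulr0.
rewrite rmorphD rmorphM /= horner_algX horner_algC mulrDl mulrDr mulr_algl mulr_algr.
by rewrite -[_ * z * u]mulrA cz mulrA IH mulrA.
Qed.

Lemma depthD k l m n (x y : QF) : depth k m x -> depth l n y ->
  depth (k + l) (m + n) (x * y).
Proof.
move=> hx hy i ikl.
have [a [am ea]] := hx (minn i k) (geq_minr _ _).
have [|b [bn eb]] := hy (i - minn i k)%N; first by lia.
exists (a * b); split.
  apply: sp_products_ind am bn => [|u v um vn]; first exact/spn_subsp/subsp_zero.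
  by apply: spn_mem; [exact: subsp_zero|exact: monomialsD].
rewrite rmorphM -[X in X = _]/(z ^+ i * ((x : Q) * (y : Q))) /= -ea -eb.
have zc j : extended_centre (z ^+ j).
  have := central_horner 'X^j; by rewrite rmorphXn /= horner_algX.
rewrite -[in LHS](subnKC (geq_minl i k)) exprD -!mulrA; congr (_ * _).
by rewrite !mulrA; congr (_ * _); exact: zc.
Qed.

Lemma horner_poly_comb J (c : nat -> K) (x : Q) :
  horner_alg z (\poly_(i < J) c i) * x = \sum_(i < J) c i *: (z ^+ i * x).
Proof.
rewrite poly_def rmorph_sum mulr_suml; apply: eq_bigr => i _.
by rewrite -mul_polyC rmorphM /= horner_algC mulr_algl rmorphXn /= horner_algX scalerAl.
Qed.

(** For x_j independent over the extended centre, a relation between the z^i x_j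
    over K reads sum_j p_j(z) x_j = 0, and each p_j(z) is zero or invertible; so
    p_j(z) = 0, and p_j = 0 as z is transcendental. *)
Lemma depth_dim k n (t : seq QF) : (0 < n)%N -> (forall x, x \in t -> depth k n x) ->
  (k.+1 * rank_mod zero_sp t <= C * n ^ 2)%N.
Proof.
move=> n0 ht; have [t' [tt' it <- _]] := rk_basis t subsp_zero.
have /choice[a ha] : forall xi : QF * nat, exists a : A, xi.1 \in t' ->
  (xi.2 <= k)%N ->
    span_mod zero_sp (monomials s n) a /\ z ^+ xi.2 * (xi.1 : Q) = mlmul a.
  move=> [x i]; case: (boolP (x \in t')) => [/tt'/ht hx|_]; last by exists 0.
  have [ik|ik] := leqP i k; last by exists 0 => /=.
  by have [b hb] := hx i ik; exists b.
pose T (r : seq QF) := [seq a (x, i) | x <- r, i <- iota 0 k.+1].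
have Tspan r : {subset r <= t'} -> forall b, span_mod zero_sp (T r) b ->
  span_mod zero_sp r (mlmul b : QF).
  move=> rt b; apply: mlmul_span => [|_ /allpairsP[[x i] [xr + ->]]].
    exact/spn_subsp/subsp_zero.
  rewrite mem_iota add0n ltnS => ik; have [_ /= e] := ha (x, i) (rt _ xr) ik.
  have zi : extended_centre (z ^+ i).
    have := central_horner 'X^i; by rewrite rmorphXn /= horner_algX.
  rewrite -e -[X in span_mod _ _ X](in_centreE zi).
  by apply: subspZ; [exact/spn_subsp/subsp_zero|apply: spn_mem => //;
    exact: subsp_zero].
have Tind r : {subset r <= t'} -> indep_mod zero_sp r -> indep_mod zero_sp (T r).
  elim: r => // x r IH rt [nx ir]; have rt' : {subset r <= t'}.
    by move=> y yr; apply: rt; rewrite inE yr orbT.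
  have -> : T (x :: r) = [seq a (x, i) | i <- iota 0 k.+1] ++ T r by [].
  apply/indep_cat; split; first exact: IH.
  apply: coef_indep => [|c]; first exact/spn_subsp/subsp_zero.
  rewrite size_map size_iota => /(Tspan r rt').
  set p := \poly_(i < k.+1) c i.
  have -> : mlmul (\sum_(i < k.+1) c i *: [seq a (x, i) | i <- iota 0 k.+1]`_i) =
      horner_alg z p * (x : Q).
    rewrite horner_poly_comb linear_sum; apply: eq_bigr => i _.
    rewrite (nth_map 0%N) ?size_iota // nth_iota // add0n linearZ.
    have [|_ /= e] := ha (x, i : nat) (rt x (mem_head _ _));
      first by rewrite /= -ltnS.
    by rewrite -e.
  move=> hp i ik; have [/polyP/(_ i)|p0] := eqVneq p 0;
    first by rewrite coef_poly ik coef0.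
  case: nx; pose d := in_centre (central_horner p).
  have d0 : d != 0.
    by apply: contra_neq (tz p0) => d0; rewrite -[LHS]/(val d) d0.
  rewrite -[x](scalerK d0); apply: subspZ; first exact/spn_subsp/subsp_zero.
  exact: hp.
have := bound n0 (Tind t' (fun x h => h) it);
  rewrite size_allpairs size_iota mulnC; apply.
move=> _ /allpairsP[[x i] [xt + ->]]; rewrite mem_iota add0n ltnS => ik.
by have [] := ha (x, i) xt ik.
Qed.

Lemma depth_mono k l m n (x : QF) : (l <= k)%N -> (m <= n)%N -> depth k m x ->
  depth l n x.
Proof.
move=> lk mn h i il; have [a [am e]] := h i (leq_trans il lk); exists a; split=> //.
by apply: spnS am => // [|y]; [exact: subsp_zero|exact: monomials_mono].
Qed.

Lemma depth_monomials n (x : QF) : x \in monomials image_gens n -> depth 0 n x.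
Proof.
move=> /monomials_mlmul[a an ->] i; rewrite leqn0 => /eqP->; exists a; rewrite mul1r.
by split=> //; apply: spn_mem => //; exact: subsp_zero.
Qed.

Lemma depth_subalg k n (x : QF) : depth k n x -> subalg image_gens x.
Proof.
move=> /(_ 0%N isT)[a [an]]; rewrite expr0 mul1r => e; exists n.
by rewrite -[X in span_mod _ _ X]/(x : Q) e; exact: span_mlmul.
Qed.

(** The element z is a map of A-modules from a nonzero ideal to A: any a in that
    ideal works, in a degree where both a and z a occur. *)
Lemma depth_exists : exists d (x : QF), x != 0 /\ depth 1 d x.
Proof.
have [p ep] : exists p, z = \pi_(martindale pA)%qT p.
  by elim/martindaleW: (z) => p; exists p.
have [a pa a0] : exists2 a, mdom p a & a != 0.
  apply: contrapT => h; have [ip] := mdomP p; apply; apply: is_ideal_eq0 => // a pa.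
  by apply/eqP; apply: contrapT => /negP a0; apply: h; exists a.
have [m am] := gen a; have [n fn] := gen (mfun p a).
exists (maxn m n), (mlmul a); split.
  by apply: contra_neq a0; exact: mlmul_inj.
have mono k l x : (k <= l)%N -> span_mod zero_sp (monomials s k) x ->
  span_mod zero_sp (monomials s l) x.
  by move=> kl; apply: spnS => // [|y]; [exact: subsp_zero|exact: monomials_mono].
case=> [|[|//]] _.
  by exists a; rewrite mul1r; split=> //; apply: mono am; rewrite leq_maxl.
exists (mfun p a); split; first by apply: mono fn; rewrite leq_maxr.
by rewrite expr1 ep; exact: mpi_mlmul.
Qed.

Lemma subalg_prime (x y : QF) : x != 0 -> y != 0 ->
  exists n b, b \in monomials image_gens n /\ x * b * y != 0.
Proof.
move=> x0 y0; have [a xay] := martindale_prime x0 y0; have [n an] := gen a.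
exists n; apply: contrapT => h; case/negP: xay; apply/eqP.
apply: (spn_min (P := [set w : QF | x * w * y = 0])) (span_mlmul an).
- split=> [|c u v /= hu hv]; first by rewrite /= mulr0 mul0r.
  by rewrite mulrDr -scalerAr mulrDl -scalerAl hu hv scaler0 addr0.
- by move=> _ -> /=; rewrite mulr0 mul0r.
move=> b bn /=; apply/eqP; apply: contrapT => /negP nz; apply: h; exists b.
by split.
Qed.

Theorem standard_identity : exists N, forall b : 'I_N -> A, stdpoly b = 0.
Proof.
have V1 : 1 \in image_gens by apply/mapP; exists 1; rewrite ?rmorph1.
have [N hN] := deep_growth_PI V1 (fun x y _ _ => @subalg_prime x y) depth_monomials
  depthD depth_mono depth_subalg depth_dim depth_exists.
exists N => b; apply: (mlmul_inj (pA := pA)).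
rewrite -[LHS]/((Defs.mlmul pA : {rmorphism A -> Q}) (stdpoly b)) rmorph_stdpoly.
by apply: hN => i; exact: subalg_mlmul.
Qed.
End TranscendentalCentre.

Theorem theorem1p3 (R : realType) (K : fieldType) (A : algType K)
    (A_prime : prime_ring A) (A_affine : affine A)
    (A_growth : quadratic_growth A R) :
  satisfies_PI A \/
  (forall z : martindale A_prime, extended_centre z ->
     algebraic_elt z).
Proof.
case: (EM (satisfies_PI A)) => [|nPI]; [by left|right=> z cz].
apply: contrapT => nalg; apply: nPI.
have tz (p : {poly K}) : p != 0 -> horner_alg z p != 0.
  by move=> p0; apply/eqP => pz; apply: nalg; exists p.
have [X [/finite_seqP[g ->] gen]] := A_affine.
pose s := 1 :: g; have s1 : 1 \in s by exact: mem_head.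
have sgen : generates [set a | a \in s].
  by move=> P hP hs; apply: gen => // v vg; apply: hs; rewrite /= inE vg orbT.
have [C bound] := quadratic_bound A_growth s1 sgen.
have [N hN] := standard_identity cz tz s1 (generates_sp s1 sgen) bound.
exact: stdpoly_satisfies_PI hN.
Qed.
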